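(* Let $\mathbb{F}$ be a field of characteristic $3$, and let $(\mathcal{C},\mu,\mathbf{n})$ be the split Cayley algebra over $\mathbb{F}$ endowed with an automorphism $\sigma$ of order $3$, so that $(\mathcal{C},\mu,\mathbf{n})$ is a composition algebra in $\mathsf{Rep}\,\mathsf{C}_3$. Let $(\mathcal{C}^{ss},\mu^{ss},\mathbf{n}^{ss})$ be its semisimplification, a unital composition superalgebra over $\mathbb F$. (1) If there is a canonical basis of $\mathcal{C}$ with $\sigma(u_1)=u_1$, $\sigma(u_2)=u_2$, $\sigma(u_3)=u_3+u_2$, then $\mathcal{C}^{ss}$ is isomorphic to the composition superalgebra $B(4,2)$. (2) If $(\sigma-\mathrm{id})^2\neq 0$ and there is a quadratic étale subalgebra $\mathcal{K}$ of $\mathcal{C}$ fixed elementwise by $\sigma$, then $\mathcal{C}^{ss}$ is isomorphic to the composition algebra $\mathcal{K}$ (with trivial odd part). (3) If there is a canonical basis of $\mathcal{C}$ with $\sigma(u_1)=u_1$, $\sigma(u_2)=u_2$, $\sigma(u_3)=u_3+v_3-(e_1-e_2)$, then $\mathcal{C}^{ss}$ is isomorphic to the composition superalgebra $B(1,2)$. (4) If there is a canonical basis of $\mathcal{C}$ with $\sigma(u_1)=u_1$, $\sigma(u_2)=u_2$, $\sigma(u_3)=u_3+u_2+v_3-(e_1-e_2)$, then $\mathcal{C}^{ss}$ is isomorphic to the composition superalgebra $B(1,2)$.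
   Context: All vector spaces are finite-dimensional over $\mathbb F$, $\operatorname{char}\mathbb F=3$; tensor products are over $\mathbb F$. **Composition algebras.** A composition algebra is $(\mathcal C,\mu,\mathbf n)$ with $\mu(x\otimes y)=xy$ a bilinear product and $\mathbf n$ a quadratic form with nondegenerate polar form $\mathbf n(x,y)=\mathbf n(x+y)-\mathbf n(x)-\mathbf n(y)$ and $\mathbf n(xy)=\mathbf n(x)\mathbf n(y)$. The polar form is also regarded as a linear map $\mathbf n:\mathcal C\otimes\mathcal C\to\mathbb F$. A Cayley algebra is a unital composition algebra of dimension $8$. The split Cayley algebra is the one having a canonical basis $e_1,e_2,u_1,u_2,u_3,v_1,v_2,v_3$ with: $e_1,e_2$ orthogonal idempotents, $e_1+e_2=1$; $e_1u_i=u_i=u_ie_2$, $e_2v_i=v_i=v_ie_1$, $e_2u_i=u_ie_1=e_1v_i=v_ie_2=0$; $u_iv_j=-\delta_{ij}e_1$, $v_iu_j=-\delta_{ij}e_2$; $u_iu_{i+1}=v_{i+2}=-u_{i+1}u_i$, $v_iv_{i+1}=u_{i+2}=-v_{i+1}v_i$ (indices mod $3$), $u_i^2=v_i^2=0$; all basis elements have norm $0$, $\mathbf n(e_1,e_2)=1=\mathbf n(u_i,v_i)$, and all other values of the polar form on pairs of basis elements are $0$, up to symmetry. An automorphism is determined by the images of $u_1,u_2,u_3$. **The superalgebras.** Let $V$ be a two-dimensional vector space with a nonzero alternating form $\langle\cdot|\cdot\rangle$. $B(1,2)=\mathbb F1\oplus V$ has even part $\mathbb F1$, odd part $V$, unity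 $1$, product $uv=\langle u|v\rangle 1$ for $u,v\in V$, and supersymmetric norm form $\mathrm n(1,1)=2$, $\mathrm n(u,v)=\langle u|v\rangle$, $\mathrm n(1,V)=\mathrm{n}(V,1)=0$. $B(4,2)=\operatorname{End}_{\mathbb F}(V)\oplus V$ has even part $\operatorname{End}_{\mathbb F}(V)$ (with composition as product), odd part $V$, and $v\cdot f=f(v)=\bar f\cdot v$, $u\cdot v=\langle\,\cdot\,|u\rangle v$ (the map $w\mapsto\langle w|u\rangle v$), where $\bar f=\operatorname{tr}(f)\mathrm{id}-f$; its norm form is the polar form of $\det$ on the even part, $\mathrm n(u,v)=\langle u|v\rangle$ on the odd part, and even and odd parts are orthogonal. **Semisimplification.** $\mathsf C_3$ is the cyclic group of order $3$ with a fixed generator, also denoted $\sigma$. $\mathsf{Rep}\,\mathsf C_3$ is the symmetric tensor category of finite-dimensional representations of $\mathsf C_3$ over $\mathbb F$ with the usual tensor product and swap. An algebra (with form) endowed with an automorphism $\sigma$ with $\sigma^3=\mathrm{id}$ is an algebra (with form) in $\mathsf{Rep}\,\mathsf C_3$. A morphism $f:X\to Y$ is negligible if $\operatorname{tr}(fg)=0$ for all morphisms $g:Y\to X$. $\mathsf{Ver}_3$ has the same objects and tensor product as $\mathsf{Rep}\,\mathsf C_3$, and $\operatorname{Hom}_{\mathsf{Ver}_3}(X,Y)=\operatorname{Hom}_{\mathsf{Rep}\,\mathsf C_3}(X,Y)/\{\text{negligible morphisms}\}$; $[f]$ is the class of $f$, and the braiding is the class of the swap. Let $V_1=\mathbb Fv_0\oplus\mathbb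 Fv_1$ with $\sigma(v_0)=v_0+v_1$, $\sigma(v_1)=v_1$, and $\lambda:V_1\otimes V_1\to\mathbb F$, $v_0\otimes v_1\mapsto1$, $v_1\otimes v_0\mapsto-1$, $v_i\otimes v_i\mapsto0$. $\mathsf{sVec}$ is the category of vector superspaces with even linear maps. There is a braided monoidal equivalence $F:\mathsf{sVec}\to\mathsf{Ver}_3$, $F(X)=X_{\bar0}\oplus(X_{\bar1}\otimes V_1)$ (with $\sigma$ acting only on $V_1$), $F(f)=[f_{\bar0}\oplus(f_{\bar1}\otimes\mathrm{id}_{V_1})]$, with monoidal structure $J_{X,Y}:F(X)\otimes F(Y)\to F(X\otimes Y)$ the class of $x_{\bar0}\otimes y_{\bar0}\mapsto x_{\bar0}\otimes y_{\bar0}$, $x_{\bar0}\otimes(y_{\bar1}\otimes v)\mapsto(x_{\bar0}\otimes y_{\bar1})\otimes v$, $(x_{\bar1}\otimes v)\otimes y_{\bar0}\mapsto(x_{\bar1}\otimes y_{\bar0})\otimes v$, $(x_{\bar1}\otimes u)\otimes(y_{\bar1}\otimes v)\mapsto\lambda(u\otimes v)\,x_{\bar1}\otimes y_{\bar1}$. The semisimplification of $(\mathcal C,\mu,\mathbf n)$ is the superalgebra with form $(\mathcal C^{ss},\mu^{ss},\mathbf n^{ss})$ in $\mathsf{sVec}$, unique up to isomorphism, such that $\bigl(F(\mathcal C^{ss}),F(\mu^{ss})\circ J,F(\mathbf n^{ss})\circ J\bigr)$ is isomorphic to $(\mathcal C,[\mu],[\mathbf n])$ in $\mathsf{Ver}_3$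 (isomorphism compatible with products and forms). *)

(* Defs.v *)
From HB Require Import structures.
From mathcomp Require Import all_boot all_order all_algebra all_field.

Set Implicit Arguments.
Unset Strict Implicit.
Unset Printing Implicit Defensive.

Import GRing.Theory passmx.
Local Open Scope ring_scope.

Reserved Notation "u ⊗ v" (at level 40, left associativity).

Section LinearAlgebra.
Variable F : fieldType.
Implicit Types U V W : vectType F.

Definition lfun_mx V (f : 'End(V)) : 'M[F]_(\dim {:V}) :=
  mxof (vbasis {:V}) (vbasis {:V}) f.
Definition lfun_tr V (f : 'End(V)) : F := \tr (lfun_mx f).
Definition lfun_det V (f : 'End(V)) : F := \det (lfun_mx f).

(* The tensor product, as the space of coordinate matrices with respect to
   the bases [vbasis {:U}] and [vbasis {:V}]. *)
Definition tens U V : vectType F := 'M[F]_(\dim {:U}, \dim {:V}).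

Definition tpure U V (u : U) (v : V) : tens U V :=
  \matrix_(i, j) (coord (vbasis {:U}) i u * coord (vbasis {:V}) j v).

Local Notation "u ⊗ v" := (tpure u v).

(* The linear map induced by [b]; meaningful when [b] is bilinear, see
   [tliftE] below. *)
Definition tlift U V W (b : U -> V -> W) : 'Hom(tens U V, W) :=
  linfun (fun M : 'M[F]_(\dim {:U}, \dim {:V}) =>
    \sum_i \sum_j M i j *: b (vbasis {:U})`_i (vbasis {:V})`_j).

Definition tmap U U' V V' (f : 'Hom(U, U')) (g : 'Hom(V, V')) :
    'Hom(tens U V, tens U' V') :=
  tlift (fun u v => f u ⊗ g v).

Fact tlift_sum_is_linear U V W (b : U -> V -> W) :
  linear (fun M : 'M[F]_(\dim {:U}, \dim {:V}) =>
    \sum_i \sum_j M i j *: b (vbasis {:U})`_i (vbasis {:V})`_j).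
Proof.
move=> a M N; rewrite scaler_sumr -big_split; apply: eq_bigr => i _ /=.
rewrite scaler_sumr -big_split; apply: eq_bigr => j _ /=.
by rewrite !mxE scalerDl scalerA.
Qed.

Lemma tliftEsum U V W (b : U -> V -> W) (M : 'M[F]_(\dim {:U}, \dim {:V})) :
  tlift b M = \sum_i \sum_j M i j *: b (vbasis {:U})`_i (vbasis {:V})`_j.
Proof.
pose L := GRing.isLinear.Build _ _ _ _ _ (tlift_sum_is_linear b).
pose f : {linear _ -> _} := HB.pack
  (fun M : 'M[F]_(\dim {:U}, \dim {:V}) =>
    \sum_i \sum_j M i j *: b (vbasis {:U})`_i (vbasis {:V})`_j) L.
exact: (lfunE f M).
Qed.

Lemma tliftE U V W (b : U -> V -> W) :
  (forall v, linear (b^~ v)) -> (forall u, linear (b u)) ->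
  forall u v, tlift b (u ⊗ v) = b u v.
Proof.
move=> bl br u v; rewrite tliftEsum.
have bl0 y : b 0 y = 0.
  by have := bl y (-1) 0 0; rewrite scaler0 addr0 scaleN1r addNr.
have br0 x : b x 0 = 0.
  by have := br x (-1) 0 0; rewrite scaler0 addr0 scaleN1r addNr.
have -> : b u v = \sum_i coord (vbasis {:U}) i u *: b (vbasis {:U})`_i v.
  rewrite {1}(coord_vbasis (memvf u)).
  elim/big_rec2: _ => [|i x y _ <-]; first exact: bl0.
  exact: bl.
apply: eq_bigr => i _.
have -> : b (vbasis {:U})`_i v
        = \sum_j coord (vbasis {:V}) j v *: b (vbasis {:U})`_i (vbasis {:V})`_j.
  rewrite {1}(coord_vbasis (memvf v)).
  elim/big_rec2: _ => [|j x y _ <-]; first exact: br0.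
  exact: br.
by rewrite scaler_sumr; apply: eq_bigr => j _; rewrite mxE scalerA.
Qed.

Lemma tpure_linearl U V (v : V) : linear ((@tpure U V)^~ v).
Proof.
by move=> a x y; apply/matrixP => i j; rewrite !mxE linearP mulrDl mulrA.
Qed.

Lemma tpure_linearr U V (u : U) : linear (@tpure U V u).
Proof.
by move=> a x y; apply/matrixP => i j; rewrite !mxE linearP mulrDr mulrCA.
Qed.

Lemma tens_span U V (M : tens U V) :
  M = tlift (@tpure U V) M.
Proof.
have fr W : free (vbasis {:W}) by exact: basis_free (vbasisP _).
rewrite tliftEsum [LHS]matrix_sum_delta.
apply: eq_bigr => i _; apply: eq_bigr => j _.
have -> : delta_mx i j = (vbasis {:U})`_i ⊗ (vbasis {:V})`_j.
  apply/matrixP => k l.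
  by rewrite !mxE !coord_free // -natrM mulnb (eq_sym k) (eq_sym l).
by [].
Qed.

Lemma tens_hom_ext U V W (f g : 'Hom(tens U V, W)) :
  (forall u v, f (u ⊗ v) = g (u ⊗ v)) -> f = g.
Proof.
move=> fg; apply/lfunP => M; rewrite (tens_span M) tliftEsum !linear_sum.
apply: eq_bigr => i _; rewrite !linear_sum; apply: eq_bigr => j _.
by rewrite !linearZ /= fg.
Qed.

Lemma tmapE U U' V V' (f : 'Hom(U, U')) (g : 'Hom(V, V')) u v :
  tmap f g (u ⊗ v) = f u ⊗ g v.
Proof.
apply: (@tliftE _ _ _ (fun u v => f u ⊗ g v)) => [y|x] a s t.
  by rewrite linearP tpure_linearl.
by rewrite linearP tpure_linearr.
Qed.

Lemma tmap_comp U U' U'' V V' V'' (f : 'Hom(U, U')) (f' : 'Hom(U', U''))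
    (g : 'Hom(V, V')) (g' : 'Hom(V', V'')) :
  (tmap f' g' \o tmap f g)%VF = tmap (f' \o f)%VF (g' \o g)%VF.
Proof. by apply: tens_hom_ext => u v; rewrite !lfunE /= !tmapE !lfunE. Qed.

Lemma tmap_id U V : tmap (\1%VF : 'End(U)) (\1%VF : 'End(V)) = \1%VF.
Proof. by apply: tens_hom_ext => u v; rewrite tmapE !lfunE. Qed.

End LinearAlgebra.

Notation "u ⊗ v" := (tpure u v) : ring_scope.

Section CompositionAlgebras.
Variable F : fieldType.

Definition polar (V : vectType F) (q : V -> F) (x y : V) : F :=
  q (x + y) - q x - q y.

Record composition_algebra := CompositionAlgebra {
  ca_space :> vectType F;
  ca_mul : {bilinear ca_space -> ca_space -> ca_space};
  ca_norm : ca_space -> F;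
  ca_normZ : forall a x, ca_norm (a *: x) = a ^+ 2 * ca_norm x;
  ca_polar_linear : forall x, scalar (polar ca_norm x);
  ca_polar_nondeg : forall x, (forall y, polar ca_norm x y = 0) -> x = 0;
  ca_normM : forall x y, ca_norm (ca_mul x y) = ca_norm x * ca_norm y
}.

Implicit Types C : composition_algebra.

Definition is_unity C (e : C) : Prop :=
  forall x : C, ca_mul C e x = x /\ ca_mul C x e = x.

Definition is_cayley C : Prop := (exists e : C, is_unity e) /\ \dim {:C} = 8%N.

(* [u i] and [v i], with [i] read modulo 3, stand for the vectors of index
   [i + 1] in the usual 1-based numbering. *)
Record canonical_basis C (e1 e2 : C) (u v : 'I_3 -> C) : Prop :=
    CanonicalBasis {
  cb_basis :
    basis_of {:C} [:: e1; e2; u 0; u 1; u 2%:R; v 0; v 1; v 2%:R];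
  cb_idem1 : ca_mul C e1 e1 = e1;
  cb_idem2 : ca_mul C e2 e2 = e2;
  cb_e12 : ca_mul C e1 e2 = 0;
  cb_e21 : ca_mul C e2 e1 = 0;
  cb_unity : is_unity (e1 + e2);
  cb_e1u : forall i, ca_mul C e1 (u i) = u i;
  cb_ue2 : forall i, ca_mul C (u i) e2 = u i;
  cb_e2v : forall i, ca_mul C e2 (v i) = v i;
  cb_ve1 : forall i, ca_mul C (v i) e1 = v i;
  cb_e2u : forall i, ca_mul C e2 (u i) = 0;
  cb_ue1 : forall i, ca_mul C (u i) e1 = 0;
  cb_e1v : forall i, ca_mul C e1 (v i) = 0;
  cb_ve2 : forall i, ca_mul C (v i) e2 = 0;
  cb_uv : forall i j, ca_mul C (u i) (v j) = - ((i == j)%:R *: e1);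
  cb_vu : forall i j, ca_mul C (v i) (u j) = - ((i == j)%:R *: e2);
  cb_uu : forall i, ca_mul C (u i) (u (i + 1)) = v (i + 2%:R);
  cb_uuN : forall i, ca_mul C (u (i + 1)) (u i) = - v (i + 2%:R);
  cb_vv : forall i, ca_mul C (v i) (v (i + 1)) = u (i + 2%:R);
  cb_vvN : forall i, ca_mul C (v (i + 1)) (v i) = - u (i + 2%:R);
  cb_u2 : forall i, ca_mul C (u i) (u i) = 0;
  cb_v2 : forall i, ca_mul C (v i) (v i) = 0;
  cb_ne1 : ca_norm e1 = 0;
  cb_ne2 : ca_norm e2 = 0;
  cb_nu : forall i, ca_norm (u i) = 0;
  cb_nv : forall i, ca_norm (v i) = 0;
  cb_ne1e2 : polar (@ca_norm C) e1 e2 = 1;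
  cb_ne1u : forall i, polar (@ca_norm C) e1 (u i) = 0;
  cb_ne1v : forall i, polar (@ca_norm C) e1 (v i) = 0;
  cb_ne2u : forall i, polar (@ca_norm C) e2 (u i) = 0;
  cb_ne2v : forall i, polar (@ca_norm C) e2 (v i) = 0;
  cb_nuv : forall i j, polar (@ca_norm C) (u i) (v j) = (i == j)%:R;
  cb_nuu : forall i j, i != j -> polar (@ca_norm C) (u i) (u j) = 0;
  cb_nvv : forall i j, i != j -> polar (@ca_norm C) (v i) (v j) = 0
}.

Definition is_split_cayley C : Prop :=
  is_cayley C /\
  exists (e1 e2 : C) (u v : 'I_3 -> C), canonical_basis e1 e2 u v.

Definition is_automorphism C (s : 'End(C)) : Prop :=
  [/\ bijective s,
      forall x y, s (ca_mul C x y) = ca_mul C (s x) (s y)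
    & forall x, ca_norm (s x) = ca_norm x].

(* An algebra is étale if it is isomorphic to a finite product of finite
   separable field extensions; the isomorphism is given by its components. *)
Definition is_etale (A : vectType F) (mul : A -> A -> A) (one : A) : Prop :=
  exists (n : nat) (L : 'I_n -> fieldExtType F) (p : forall i, 'Hom(A, L i)),
    [/\ forall i, separable 1 {:L i},
        forall i x y, p i (mul x y) = p i x * p i y,
        forall i, p i one = 1
      & forall y : (forall i, L i), exists! x : A, forall i, p i x = y i].

(* The product of [C] restricted to [K], when [K] is closed under it. *)
Definition sub_mul C (K : {vspace C}) (x y : subvs_of K) : subvs_of K :=
  vsproj K (ca_mul C (vsval x) (vsval y)).

Definition quadratic_etale_subalgebra C (K : {vspace C}) : Prop :=
  \dim K = 2%N /\
  exists e : C, [/\ is_unity e, e \in K,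
    forall x y, x \in K -> y \in K -> ca_mul C x y \in K
  & is_etale (@sub_mul C K) (vsproj K e)].

End CompositionAlgebras.

Section Superspaces.
Variable F : fieldType.

Record svec := SVec { even : vectType F; odd : vectType F }.

Record shom (X Y : svec) := SHom {
  hom_even : 'Hom(even X, even Y);
  hom_odd : 'Hom(odd X, odd Y)
}.

Definition scomp X Y Z (g : shom Y Z) (f : shom X Y) : shom X Z :=
  SHom (hom_even g \o hom_even f)%VF (hom_odd g \o hom_odd f)%VF.

Definition pair_map (U U' V V' : vectType F) (f : 'Hom(U, U')) (g : 'Hom(V, V')) :
    'Hom((U * V)%type, (U' * V')%type) :=
  linfun (fun p : U * V => (f p.1, g p.2)).

Definition sunit : svec := SVec F^o 'rV[F]_0.

Definition stens (X Y : svec) : svec :=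
  SVec (tens (even X) (even Y) * tens (odd X) (odd Y))%type
       (tens (even X) (odd Y) * tens (odd X) (even Y))%type.

Definition stmap X X' Y Y' (f : shom X X') (g : shom Y Y') :
    shom (stens X Y) (stens X' Y') :=
  SHom (X := stens X Y) (Y := stens X' Y')
    (pair_map (tmap (hom_even f) (hom_even g)) (tmap (hom_odd f) (hom_odd g)))
    (pair_map (tmap (hom_even f) (hom_odd g)) (tmap (hom_odd f) (hom_even g))).

Record superalgebra := Superalgebra {
  sa_space :> svec;
  sa_mul : shom (stens sa_space sa_space) sa_space;
  sa_form : shom (stens sa_space sa_space) sunit
}.

Definition superalgebra_iso (S T : superalgebra) : Prop :=
  exists f : shom S T,
    [/\ bijective (hom_even f), bijective (hom_odd f),
        scomp f (sa_mul S) = scomp (sa_mul T) (stmap f f)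
      & sa_form S = scomp (sa_form T) (stmap f f)].

(* The superalgebra with form given by the components of its product and of
   its form, which are meant to be bilinear. *)
Definition superalgebra_of (A0 A1 : vectType F)
    (m00 : A0 -> A0 -> A0) (m01 : A0 -> A1 -> A1)
    (m10 : A1 -> A0 -> A1) (m11 : A1 -> A1 -> A0)
    (n0 : A0 -> A0 -> F) (n1 : A1 -> A1 -> F) : superalgebra :=
  let A := SVec A0 A1 in
  @Superalgebra A
    (SHom (X := stens A A) (Y := A)
       (linfun (fun p => tlift m00 p.1 + tlift m11 p.2))
       (linfun (fun p => tlift m01 p.1 + tlift m10 p.2)))
    (SHom (X := stens A A) (Y := sunit)
       (linfun (fun p => tlift (n0 : A0 -> A0 -> F^o) p.1
                       + tlift (n1 : A1 -> A1 -> F^o) p.2))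
       0).

Section B.
Variables (V : vectType F) (form : {biscalar V}).

Definition B12 : superalgebra :=
  @superalgebra_of F^o V
    (fun a b => a * b) (fun a v => a *: v) (fun v a => a *: v)
    (fun u v => form u v)
    (fun a b => 2%:R * (a * b)) (fun u v => form u v).

Definition lfun_bar (f : 'End(V)) : 'End(V) := lfun_tr f *: \1%VF - f.

(* The product [f . v] is [lfun_bar f v] because
   [lfun_bar (lfun_bar f) = f]. *)
Definition B42 : superalgebra :=
  @superalgebra_of 'End(V) V
    (fun f g => (f \o g)%VF) (fun f v => lfun_bar f v) (fun v f => f v)
    (fun u v => linfun (fun w => form w u *: v))
    (fun f g => polar (@lfun_det F V) f g) (fun u v => form u v).

End B.

Definition sub_superalgebra (C : composition_algebra F) (K : {vspace C}) :
    superalgebra :=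
  @superalgebra_of (subvs_of K) 'rV[F]_0
    (@sub_mul F C K) (fun _ _ => 0) (fun _ _ => 0) (fun _ _ => 0)
    (fun x y => polar (@ca_norm F C) (vsval x) (vsval y)) (fun _ _ => 0).

End Superspaces.

Section Semisimplification.
Variable F : fieldType.

Record rep := Rep {
  rep_space :> vectType F;
  rep_gen : 'End(rep_space);
  rep_gen3 : (rep_gen \o rep_gen \o rep_gen)%VF = \1%VF
}.

Definition equivariant (X Y : rep) (f : 'Hom(X, Y)) : Prop :=
  (f \o rep_gen X)%VF = (rep_gen Y \o f)%VF.

Definition negligible (X Y : rep) (f : 'Hom(X, Y)) : Prop :=
  forall g : 'Hom(Y, X), equivariant g -> lfun_tr (f \o g)%VF = 0.

(* Equality of the classes of two morphisms in the semisimplification. *)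
Definition ver_eq (X Y : rep) (f g : 'Hom(X, Y)) : Prop := negligible (f - g).

Fact rep_unit_subproof :
  (\1 \o \1 \o \1)%VF = \1%VF :> 'End(F^o).
Proof. by rewrite !comp_lfun1l. Qed.

Definition rep_unit : rep := Rep rep_unit_subproof.

Fact rep_tens_subproof (X Y : rep) :
  let s := tmap (rep_gen X) (rep_gen Y) in (s \o s \o s)%VF = \1%VF.
Proof. by rewrite /= !tmap_comp !rep_gen3 tmap_id. Qed.

Definition rep_tens (X Y : rep) : rep := Rep (rep_tens_subproof X Y).

Definition V1_space : vectType F := 'rV[F]_2.

Definition V1_gen : 'End(V1_space) :=
  linfun (fun x : 'rV[F]_2 => x + x 0 0 *: delta_mx 0 1).

Definition lambda (x y : V1_space) : F :=
  (x : 'rV_2) 0 0 * (y : 'rV_2) 0 1 - (x : 'rV_2) 0 1 * (y : 'rV_2) 0 0.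

Hypothesis char3 : 3%N \in [pchar F].

Lemma V1_genE (x : 'rV[F]_2) : V1_gen x = x + x 0 0 *: delta_mx 0 1.
Proof.
have lin : linear (fun x : 'rV[F]_2 => x + x 0 0 *: delta_mx 0 1 : 'rV[F]_2).
  move=> a y z; rewrite !mxE scalerDl scalerDr scalerA.
  by rewrite addrACA.
pose L := GRing.isLinear.Build _ _ _ _ _ lin.
pose f : {linear _ -> _} := HB.pack
  (fun x : 'rV[F]_2 => x + x 0 0 *: delta_mx 0 1 : 'rV[F]_2) L.
exact: (lfunE f x).
Qed.

Fact V1_subproof : (V1_gen \o V1_gen \o V1_gen)%VF = \1%VF.
Proof.
apply/lfunP => x; rewrite !lfunE /= !lfunE /= !V1_genE !mxE /= !mulr0 !addr0.
rewrite -!addrA; set d := _ *: _; rewrite -[RHS]addr0; congr (_ + _).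
have -> : d + (d + d) = d *+ 3 by [].
by rewrite -scaler_nat (pcharf0 char3) scale0r.
Qed.

Definition V1 : rep := Rep V1_subproof.

(* The equivalence from superspaces to representations up to negligible
   morphisms: [ssF] on objects, [ssF_map] on morphisms, [ssJ] its monoidal
   structure, and [ssF_unit] the identification of the image of the unit
   object with the unit object. *)
Definition ssF_gen (X : svec F) : 'End((even X * tens (odd X) V1)%type) :=
  pair_map \1%VF (tmap \1%VF (rep_gen V1)).

Lemma pair_mapE (U U' V V' : vectType F) (f : 'Hom(U, U')) (g : 'Hom(V, V'))
  (p : U * V) : pair_map f g p = (f p.1, g p.2).
Proof.
have lin : linear (fun p : U * V => (f p.1, g p.2)).
  by move=> a y z; rewrite /= !linearP.
pose L := GRing.isLinear.Build _ _ _ _ _ lin.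
pose h : {linear _ -> _} := HB.pack (fun p : U * V => (f p.1, g p.2)) L.
exact: (lfunE h p).
Qed.

Fact ssF_subproof (X : svec F) :
  (ssF_gen X \o ssF_gen X \o ssF_gen X)%VF = \1%VF.
Proof.
apply/lfunP => -[x y]; rewrite !lfunE /= !lfunE /= !pair_mapE /= !lfunE /=.
rewrite -[in RHS](id_lfunE y) -tmap_id; congr (_, _).
have /(congr1 (fun f : 'End(_) => f y)) :
  tmap \1%VF (rep_gen V1 \o rep_gen V1 \o rep_gen V1)%VF
  = (tmap \1%VF (rep_gen V1) \o tmap \1%VF (rep_gen V1)
      \o tmap \1%VF (rep_gen V1))%VF :> 'End(tens (odd X) V1).
  by rewrite !tmap_comp !comp_lfun1l.
by rewrite rep_gen3 !lfunE /= !lfunE.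
Qed.

Definition ssF (X : svec F) : rep := Rep (ssF_subproof X).

Definition ssF_map (X Y : svec F) (f : shom X Y) : 'Hom(ssF X, ssF Y) :=
  pair_map (hom_even f) (tmap (hom_odd f) \1%VF).

Definition ssJ (X Y : svec F) :
    'Hom(rep_tens (ssF X) (ssF Y), ssF (stens X Y)) :=
  tlift (fun (p : even X * tens (odd X) V1) (q : even Y * tens (odd Y) V1) =>
    ((p.1 ⊗ q.1,
      tlift (fun x s => tlift (fun y t => lambda s t *: (x ⊗ y)) q.2) p.2),
     tlift (fun y t => ((p.1 ⊗ y, 0) : odd (stens X Y)) ⊗ t) q.2
     + tlift (fun x s => ((0, x ⊗ q.1) : odd (stens X Y)) ⊗ s) p.2)
    : ssF (stens X Y)).

Definition ssF_unit : 'Hom(ssF (sunit F), rep_unit) :=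
  linfun (fun p : F^o * tens 'rV[F]_0 V1 => p.1).

(* [S] is a semisimplification of the algebra with form [(A, mu, n)]. *)
Definition is_semisimplification (A : rep) (mu : 'Hom(rep_tens A A, A))
    (n : 'Hom(rep_tens A A, rep_unit)) (S : superalgebra F) : Prop :=
  exists (f : 'Hom(ssF S, A)) (g : 'Hom(A, ssF S)),
    [/\ equivariant f /\ equivariant g,
        @ver_eq (ssF S) (ssF S) (g \o f)%VF \1%VF /\
        @ver_eq A A (f \o g)%VF \1%VF,
        @ver_eq (rep_tens (ssF S) (ssF S)) A
          (f \o (ssF_map (sa_mul S) \o ssJ S S))%VF (mu \o tmap f f)%VF
      & @ver_eq (rep_tens (ssF S) (ssF S)) rep_unit
          (ssF_unit \o (ssF_map (sa_form S) \o ssJ S S))%VF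
          (n \o tmap f f)%VF].

Section CompositionAlgebra.
Variables (C : composition_algebra F) (s : 'End(C)).
Hypothesis s3 : (s \o s \o s)%VF = \1%VF.

Definition ca_semisimplification (S : superalgebra F) : Prop :=
  @is_semisimplification (Rep s3) (tlift (ca_mul C))
    (tlift (fun x y : C => polar (@ca_norm F C) x y : F^o)) S.

(* The semisimplification exists, and is isomorphic to [T]. *)
Definition ca_semisimplification_iso (T : superalgebra F) : Prop :=
  (exists S, ca_semisimplification S) /\
  (forall S, ca_semisimplification S -> superalgebra_iso S T).

End CompositionAlgebra.

End Semisimplification.

(* Main.v *)
Require Import Defs.
From HB Require Import structures.
From mathcomp Require Import all_boot all_order all_algebra all_field.
From mathcomp Require Import ring zify.

Set Implicit Arguments.
Unset Strict Implicit.
Unset Printing Implicit Defensive.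

Import GRing.Theory passmx.
Local Open Scope ring_scope.

(** Write [N = s - 1], so that [N^3 = 0] in characteristic 3.  A linear map
    [phi] between representations yields the equivariant trace map
    [N^2 phi + N phi N + phi N^2], whose composites with equivariant maps have
    a trace divisible by 3; hence trace maps, and with them the projections
    onto free summands, are negligible.  On the other hand an equivariant map
    out of [ssF X] which sends the even part into the image of [N] and the
    socle of [odd X ⊗ V1] into the image of [N^2] is negligible, because its
    composites with equivariant maps are then nilpotent on the multiplicity
    spaces.  These two facts make [ssF] full and faithful and [ssJ] invertible
    modulo negligible morphisms.  Together with the partial trace, which shows
    that negligible morphisms form a tensor ideal, this gives the uniqueness of
    the semisimplification.

    For existence, decompose [C] into Jordan blocks of [s].  The blocks of
    size 1, 2 and 3 span the images of [f0], of [f1] and [N f1], and of [f2],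
    [N f2] and [N^2 f2].  The last ones are dropped, so [C] becomes
    [ssF (E, O)], and the products of the semisimplification are read off
    modulo the image of [N], the odd-odd one on the invariant vector of
    [V1 ⊗ V1].

    When [s] fixes a quadratic étale subalgebra [K] and [N^2 <> 0], the algebra
    [C] is the sum of [K] and two blocks of size 3.  A generator [i] of [K] with
    trace 0 acts on the image of [N^2]: either some [z] and [i z] are
    independent, or [z] is an eigenvector of [i], and then pairing [z] with [C]
    under the norm produces an eigenvector for the opposite eigenvalue. *)

(** * Traces and negligible morphisms *)

Section Trace.
Variable F : fieldType.
Implicit Types U V W : vectType F.

(** Linearity enters as a hypothesis here, so that [linfun] of a bare function can be evaluated
    without declaring a canonical structure. *)
Lemma linfunE U V (f : U -> V) : linear f -> forall x, linfun f x = f x.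
Proof.
move=> lf x; pose L := GRing.isLinear.Build _ _ _ _ _ lf.
pose g : {linear _ -> _} := HB.pack f L.
exact: (lfunE g x).
Qed.

Lemma tpureZl U V a (u : U) (v : V) : (a *: u) ⊗ v = a *: (u ⊗ v).
Proof. by apply/matrixP => i j; rewrite !mxE linearZ /= mulrA. Qed.

HB.instance Definition _ U V (u : U) :=
  GRing.isLinear.Build F V (tens U V) *:%R (@tpure F U V u)
    (@tpure_linearr F U V u).

Lemma lfun_trC U V (f : 'Hom(U, V)) (g : 'Hom(V, U)) :
  lfun_tr (f \o g)%VF = lfun_tr (g \o f)%VF.
Proof.
rewrite /lfun_tr /lfun_mx.
rewrite (mxof_comp _ _ (vbasisP {:V})) (mxof_comp _ _ (vbasisP {:U})).
exact: mxtrace_mulC.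
Qed.

Lemma lfun_tr_is_scalar U : scalar (@lfun_tr F U).
Proof. by move=> a f g; rewrite /lfun_tr /lfun_mx linearP /= linearP. Qed.

HB.instance Definition _ U :=
  GRing.isLinear.Build F 'End(U) F *%R (@lfun_tr F U) (@lfun_tr_is_scalar U).

Lemma comp_lfun_suml U V W I (r : seq I) (f : I -> 'Hom(V, W)) (g : 'Hom(U, V)) :
  ((\sum_(i <- r) f i) \o g)%VF = \sum_(i <- r) (f i \o g)%VF.
Proof.
apply/lfunP => x; rewrite comp_lfunE !sum_lfunE.
by apply: eq_bigr => i _; rewrite comp_lfunE.
Qed.

Lemma comp_lfun_sumr U V W I (r : seq I) (f : I -> 'Hom(U, V)) (g : 'Hom(V, W)) :
  (g \o (\sum_(i <- r) f i))%VF = \sum_(i <- r) (g \o f i)%VF.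
Proof.
apply/lfunP => x; rewrite comp_lfunE !sum_lfunE linear_sum.
by apply: eq_bigr => i _; rewrite comp_lfunE.
Qed.

Lemma lfun_mxE U (f : 'End(U)) i j :
  lfun_mx f i j = coord (vbasis {:U}) j (f (vbasis {:U})`_i).
Proof.
rewrite /lfun_mx /mxof.
have -> : lin1_mx (rVof (vbasis {:U}) \o f \o vecof (vbasis {:U})) i j
   = (rVof (vbasis {:U}) (f (vecof (vbasis {:U}) (delta_mx 0 i)))) 0 j.
  by rewrite mxE.
by rewrite vecof_delta mxE.
Qed.

Lemma lfun_trE U (f : 'End(U)) :
  lfun_tr f = \sum_i coord (vbasis {:U}) i (f (vbasis {:U})`_i).
Proof. by apply: eq_bigr => i _; rewrite lfun_mxE. Qed.

(** The trace pairing is nondegenerate: against the rank-one map sending [y] to its [i]-th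
    coordinate times [x], the trace is the [i]-th coordinate of [f x]. *)
Lemma lfun_tr_eq0 U V (f : 'Hom(U, V)) :
  (forall g : 'Hom(V, U), lfun_tr (f \o g)%VF = 0) -> f = 0.
Proof.
move=> f0; apply/lfunP => x; rewrite zero_lfunE; set v := f x.
rewrite (coord_vbasis (memvf v)) big1 // => i _.
suff -> : coord (vbasis {:V}) i v = 0 by rewrite scale0r.
pose g : 'Hom(V, U) := linfun (fun y => coord (vbasis {:V}) i y *: x).
have gE y : g y = coord (vbasis {:V}) i y *: x.
  by apply: linfunE => a z t; rewrite linearP scalerDl scalerA.
rewrite -(f0 g) lfun_trE (bigD1 i) //= big1 => [|j nji].
  rewrite addr0 comp_lfunE gE linearZ /= coord_free ?(basis_free (vbasisP _)) //.
  by rewrite eqxx scale1r.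
rewrite comp_lfunE gE linearZ /= coord_free ?(basis_free (vbasisP _)) //.
by rewrite (negPf nji) scale0r linear0.
Qed.

End Trace.

Lemma pchar3_double_eq0 (F : fieldType) (a : F) :
  3%N \in [pchar F] -> 2%:R * a = 0 -> a = 0.
Proof.
move=> char3 a2; have -> : a = 3%:R * a - 2%:R * a by ring.
by rewrite (pcharf0 char3) mul0r a2 subr0.
Qed.

(** * Rewriting rules for linear maps and pure tensors *)

Section LinearMaps.
Variable F : fieldType.

Section LfunLinear.
Variables (U V : vectType F) (f : 'Hom(U, V)).
Lemma lfun0E : f 0 = 0. Proof. exact: linear0. Qed.
Lemma lfunD x y : f (x + y) = f x + f y. Proof. exact: linearD. Qed.
Lemma lfunB x y : f (x - y) = f x - f y. Proof. exact: linearB. Qed.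
Lemma lfunZ a x : f (a *: x) = a *: f x. Proof. exact: linearZ. Qed.
End LfunLinear.

Lemma tpureDl (U V : vectType F) (u u' : U) (v : V) :
  (u + u') ⊗ v = u ⊗ v + u' ⊗ v.
Proof. by apply/matrixP => i j; rewrite !mxE linearD mulrDl. Qed.

Lemma tpureDr (U V : vectType F) (u : U) (v v' : V) :
  u ⊗ (v + v') = u ⊗ v + u ⊗ v'.
Proof. exact: linearD. Qed.

(** Scalars are absorbed into the left factor of a pure tensor, so closure under sums suffices. *)
Lemma tens_ind (U V : vectType F) (P : tens U V -> Prop) :
  P 0 -> (forall M N, P M -> P N -> P (M + N)) -> (forall u v, P (u ⊗ v)) ->
  forall M, P M.
Proof.
move=> P0 PD Pt M; rewrite (tens_span M) tliftEsum.
by apply: big_ind => // i _; apply: big_ind => // j _; rewrite -tpureZl.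
Qed.

Lemma tpure0l (U V : vectType F) (v : V) : (0 : U) ⊗ v = 0.
Proof. by apply/matrixP => i j; rewrite !mxE linear0 mul0r. Qed.

End LinearMaps.

(** * Equivariant maps and the tensor ideal of negligible morphisms *)

Section Negligible.
Variable F : fieldType.
Implicit Types X Y Z W : rep F.

Lemma equivariantE X Y (f : 'Hom(X, Y)) :
  equivariant f <-> forall x, f (rep_gen X x) = rep_gen Y (f x).
Proof.
split=> [e x|e]; first by move/lfunP: e => /(_ x); rewrite !lfunE.
by apply/lfunP => x; rewrite !lfunE /= e.
Qed.

Lemma equivariant_id X : @equivariant _ X X \1%VF.
Proof. by rewrite /equivariant comp_lfun1l comp_lfun1r. Qed.

Lemma equivariant_comp X Y Z (f : 'Hom(X, Y)) (g : 'Hom(Y, Z)) :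
  equivariant f -> equivariant g -> @equivariant _ X Z (g \o f)%VF.
Proof.
by move=> ef eg; rewrite /equivariant -comp_lfunA ef comp_lfunA eg comp_lfunA.
Qed.

Lemma equivariantB X Y (f g : 'Hom(X, Y)) :
  equivariant f -> equivariant g -> equivariant (f - g).
Proof.
move=> /equivariantE ef /equivariantE eg; apply/equivariantE => x.
by rewrite !add_lfunE !opp_lfunE ef eg linearB.
Qed.

Lemma equivariant_tmap X X' Y Y' (f : 'Hom(X, X')) (g : 'Hom(Y, Y')) :
  equivariant f -> equivariant g ->
  @equivariant _ (rep_tens X Y) (rep_tens X' Y') (tmap f g).
Proof. by move=> ef eg; rewrite /equivariant /= !tmap_comp ef eg. Qed.

Lemma negligibleD X Y (f g : 'Hom(X, Y)) :
  negligible f -> negligible g -> negligible (f + g).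
Proof. by move=> nf ng h eh; rewrite comp_lfunDl linearD /= nf // ng ?addr0. Qed.

Lemma negligibleN X Y (f : 'Hom(X, Y)) : negligible f -> negligible (- f).
Proof. by move=> nf h eh; rewrite comp_lfunNl linearN /= nf ?oppr0. Qed.

Lemma negligible0 X Y : @negligible _ X Y 0.
Proof. by move=> h eh; rewrite comp_lfun0l linear0. Qed.

(** By cyclicity of the trace, [g] moves over to the test morphism. *)
Lemma negligible_compl X Y Z (f : 'Hom(X, Y)) (g : 'Hom(Y, Z)) :
  negligible f -> equivariant g -> @negligible _ X Z (g \o f)%VF.
Proof.
move=> nf eg h eh; rewrite -comp_lfunA lfun_trC -comp_lfunA nf //.
exact: equivariant_comp eg eh.
Qed.

Lemma negligible_compr X Y Z (f : 'Hom(X, Y)) (g : 'Hom(Y, Z)) :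
  equivariant f -> negligible g -> @negligible _ X Z (g \o f)%VF.
Proof.
move=> ef ng h eh; rewrite -comp_lfunA ng //.
exact: equivariant_comp eh ef.
Qed.

Lemma ver_eq_refl X Y (f : 'Hom(X, Y)) : ver_eq f f.
Proof. by rewrite /ver_eq subrr; apply: negligible0. Qed.

Lemma ver_eq_sym X Y (f g : 'Hom(X, Y)) : ver_eq f g -> ver_eq g f.
Proof. by move=> /negligibleN; rewrite opprB. Qed.

Lemma ver_eq_trans X Y (f g h : 'Hom(X, Y)) :
  ver_eq f g -> ver_eq g h -> ver_eq f h.
Proof. by move=> nf /(negligibleD nf); rewrite addrA subrK. Qed.

Definition tswap (U V : vectType F) : 'Hom(tens U V, tens V U) :=
  tlift (fun u v => v ⊗ u).

Lemma tswapE (U V : vectType F) (u : U) (v : V) : tswap U V (u ⊗ v) = v ⊗ u.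
Proof.
by apply: (@tliftE _ _ _ _ (fun u v => v ⊗ u)) => [y|x] a s t;
  rewrite ?tpure_linearl ?tpure_linearr.
Qed.

Lemma equivariant_tswap X Y :
  @equivariant _ (rep_tens X Y) (rep_tens Y X) (tswap X Y).
Proof.
by apply: tens_hom_ext => u v; rewrite !comp_lfunE /= !(tmapE, tswapE).
Qed.

Section PartialTrace.
Variables (U V : vectType F).

Definition tcontract (phi : V -> F) : 'Hom(tens U V, U) :=
  tlift (fun u v => phi v *: u).

Lemma tcontractE (phi : {scalar V}) u v : tcontract phi (u ⊗ v) = phi v *: u.
Proof.
apply: (@tliftE _ _ _ _ (fun u v => phi v *: u)) => [y|x] a s t.
  by rewrite scalerDr !scalerA mulrC.
by rewrite linearP scalerDl scalerA.
Qed.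

Definition tinsert (v : V) : 'Hom(U, tens U V) := linfun (fun u => u ⊗ v).

Lemma tinsertE v u : tinsert v u = u ⊗ v.
Proof. exact/linfunE/tpure_linearl. Qed.

(** Cuts a trace on [tens U V] into traces on [U], one for each basis vector of [V]. *)
Lemma tens_resolution :
  \sum_(j < _) (tinsert (vbasis {:V})`_j \o tcontract (coord (vbasis {:V}) j))%VF = \1%VF.
Proof.
apply: tens_hom_ext => u v; rewrite sum_lfunE id_lfunE.
rewrite {2}(coord_vbasis (memvf v)).
rewrite linear_sum; apply: eq_bigr => j _ /=.
by rewrite comp_lfunE tcontractE tinsertE tpureZl linearZ.
Qed.

End PartialTrace.

(* The partial trace of [g] over [Z] is an equivariant map [Y -> X] whose
   composite with [f] has the trace of [(f ⊗ 1) g]. *)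
Lemma negligible_tmap1 X Y Z (f : 'Hom(X, Y)) :
  negligible f ->
  @negligible _ (rep_tens X Z) (rep_tens Y Z) (tmap f (\1%VF : 'End(Z))).
Proof.
move=> nf g /equivariantE eg.
pose b := vbasis {:Z}.
pose pg : 'Hom(Y, X) :=
  \sum_(j < _) (tcontract X (coord b j) \o (g \o tinsert Y b`_j))%VF.
have -> : lfun_tr (tmap f \1 \o g)%VF = lfun_tr (f \o pg)%VF.
  rewrite -[(tmap f _ \o g)%VF]comp_lfun1l -(tens_resolution Y Z).
  rewrite comp_lfun_suml comp_lfun_sumr !linear_sum; apply: eq_bigr => j _ /=.
  rewrite -comp_lfunA lfun_trC; congr lfun_tr; rewrite !comp_lfunA.
  congr (_ \o _ \o _)%VF; apply: tens_hom_ext => u v.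
  by rewrite !comp_lfunE tmapE !tcontractE id_lfunE linearZ.
apply: nf; apply/equivariantE => y.
rewrite !sum_lfunE linear_sum /=.
(* Since the generator has order dividing 3, its inverse is its square. *)
have [s3 s3K Ks3] : exists2 s3 : 'End(Z),
    cancel (rep_gen Z) s3 & cancel s3 (rep_gen Z).
  exists (rep_gen Z \o rep_gen Z)%VF => z;
    by rewrite -[RHS](id_lfunE z) -(rep_gen3 Z) !comp_lfunE.
(* The generator passes through a contraction if the functional is precomposed with its inverse. *)
have pushX j (w : tens X Z) :
    rep_gen X (tcontract X (coord b j) w)
    = tcontract X (coord b j \o s3) (rep_gen (rep_tens X Z) w).
  pose l := (rep_gen X \o tcontract X (coord b j))%VF.
  pose r := (tcontract X (coord b j \o s3) \o rep_gen (rep_tens X Z))%VF.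
  suff /lfunP/(_ w) : l = r by rewrite !comp_lfunE.
  apply: tens_hom_ext => u v.
  by rewrite !comp_lfunE /= tmapE !tcontractE linearZ /= s3K.
pose G k := g (rep_gen Y y ⊗ b`_k).
transitivity (\sum_(j < _) \sum_(k < _) coord b k (rep_gen Z b`_j) *:
    tcontract X (coord b j \o s3) (G k)); last first.
  apply: eq_bigr => j _.
  rewrite 2!comp_lfunE tinsertE pushX -eg /= tmapE.
  rewrite [in RHS](coord_vbasis (memvf (rep_gen Z b`_j))).
  rewrite !linear_sum /=; apply: eq_bigr => k _.
  by rewrite !linearZ.
rewrite exchange_big; apply: eq_bigr => k _ /=.
rewrite 2!comp_lfunE tinsertE -/(G k).
set w := G k; rewrite (tens_span w) tliftEsum.
rewrite linear_sum; under [RHS]eq_bigr do rewrite linear_sum scaler_sumr.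
rewrite [RHS]exchange_big; apply: eq_bigr => i _ /=.
rewrite linear_sum; under [RHS]eq_bigr do rewrite linear_sum scaler_sumr.
rewrite [RHS]exchange_big; apply: eq_bigr => l _ /=.
rewrite linearZ /= tcontractE -{1}[b`_l]Ks3.
rewrite {1}(coord_vbasis (memvf (s3 b`_l))) !linear_sum /= scaler_suml scaler_sumr.
apply: eq_bigr => j _.
rewrite [rep_gen Z _]linearZ [coord _ _ _]linearZ /=
  [tcontract X (coord b j \o s3) _]linearZ /= tcontractE /= !scalerA.
by congr (_ *: _); rewrite -/b; ring.
Qed.

(** One factor is changed at a time, passing through [tmap f' g]; the second factor is reduced to
    the first by conjugating with the swap. *)
Lemma ver_eq_tmap X X' Y Y' (f f' : 'Hom(X, X')) (g g' : 'Hom(Y, Y')) :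
  equivariant f' -> equivariant g ->
  ver_eq f f' -> ver_eq g g' ->
  @ver_eq _ (rep_tens X Y) (rep_tens X' Y') (tmap f g) (tmap f' g').
Proof.
move=> ef' eg nf ng.
have tmapBl (h h' : 'Hom(X, X')) (k : 'Hom(Y, Y')) :
    tmap h k - tmap h' k = tmap (h - h') k.
  apply: tens_hom_ext => u v.
  rewrite add_lfunE opp_lfunE !tmapE add_lfunE opp_lfunE.
  by rewrite -[X in _ = X]tinsertE linearB /= !tinsertE.
have tmapBr (h : 'Hom(X, X')) (k k' : 'Hom(Y, Y')) :
    tmap h k - tmap h k' = tmap h (k - k').
  apply: tens_hom_ext => u v.
  by rewrite add_lfunE opp_lfunE !tmapE add_lfunE opp_lfunE linearB.
apply: (@ver_eq_trans (rep_tens X Y) (rep_tens X' Y') _ (tmap f' g)).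
  rewrite /ver_eq tmapBl.
  have -> : tmap (f - f') g = (tmap (f - f') \1 \o tmap \1 g)%VF.
    by rewrite tmap_comp comp_lfun1l comp_lfun1r.
  apply: (@negligible_compr (rep_tens X Y) (rep_tens X Y')).
    exact: equivariant_tmap (@equivariant_id _) eg.
  exact: negligible_tmap1.
rewrite /ver_eq tmapBr.
have -> : tmap f' (g - g')
   = (tswap Y' X' \o (tmap (g - g') \1 \o tswap X' Y) \o tmap f' \1)%VF.
  by apply: tens_hom_ext => u v; rewrite !comp_lfunE !(tmapE, tswapE) !id_lfunE.
apply: (@negligible_compr (rep_tens X Y) (rep_tens X' Y)).
  exact: (@equivariant_tmap X X' Y Y _ _ ef' (@equivariant_id Y)).
apply: (@negligible_compl _ (rep_tens Y' X')); last exact: equivariant_tswap.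
apply: (@negligible_compr _ (rep_tens Y X')); first exact: equivariant_tswap.
exact: negligible_tmap1.
Qed.

Definition nilgen X : 'End(X) := rep_gen X - \1%VF.

Lemma nilgenE X (x : X) : nilgen X x = rep_gen X x - x.
Proof. by rewrite add_lfunE opp_lfunE id_lfunE. Qed.

Lemma equivariant_nilgen X Y (f : 'Hom(X, Y)) x :
  equivariant f -> f (nilgen X x) = nilgen Y (f x).
Proof. by move=> /equivariantE ef; rewrite !nilgenE linearB /= ef. Qed.

Hypothesis char3 : 3%N \in [pchar F].

Lemma mulrn3_eq0 (V : lmodType F) (v : V) : v *+ 3 = 0.
Proof. by rewrite -scaler_nat (pcharf0 char3) scale0r. Qed.

(** With σ^3 = 1 the expansion of (σ - 1)^3 collapses to 3(σ - σ^2). *)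
Lemma nilgen3 X (x : X) : nilgen X (nilgen X (nilgen X x)) = 0.
Proof.
rewrite !nilgenE !linearB /=.
have -> : rep_gen X (rep_gen X (rep_gen X x)) = x.
  by rewrite -[RHS](id_lfunE x) -(rep_gen3 X) !comp_lfunE.
set a := rep_gen X (rep_gen X x); set b := rep_gen X x.
rewrite -[RHS](mulrn3_eq0 (b - a)) !opprK [- a + b]addrC [_ + (b - x)]addrC.
by rewrite addrACA [x - a + _]addrC subrKA.
Qed.

Lemma equivariant_nilgen_comp X Y (f : 'Hom(X, Y)) :
  equivariant f -> (f \o nilgen X = nilgen Y \o f)%VF.
Proof. by move=> ef; apply/lfunP => x; rewrite !comp_lfunE equivariant_nilgen. Qed.

(** Composed with an equivariant [g], which commutes with N, each of the three summands has by
    cyclicity the trace of [phi] N^2 [g]; the total is three times that scalar. *)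
Lemma negligible_nilgen2 X Y (phi : 'Hom(X, Y)) :
  negligible ((nilgen Y \o (nilgen Y \o phi)) + (nilgen Y \o (phi \o nilgen X))
              + (phi \o (nilgen X \o nilgen X)))%VF.
Proof.
move=> g eg; pose t := lfun_tr (phi \o (nilgen X \o (nilgen X \o g)))%VF.
have gN := equivariant_nilgen_comp eg.
rewrite 2!comp_lfunDl 2!linearD /=.
have -> : lfun_tr ((nilgen Y \o (nilgen Y \o phi)) \o g)%VF = t.
  rewrite -comp_lfunA lfun_trC -!comp_lfunA lfun_trC -comp_lfunA gN.
  by rewrite -comp_lfunA comp_lfunA gN -comp_lfunA.
have -> : lfun_tr ((nilgen Y \o (phi \o nilgen X)) \o g)%VF = t.
  by rewrite -comp_lfunA lfun_trC -!comp_lfunA gN.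
have -> : lfun_tr ((phi \o (nilgen X \o nilgen X)) \o g)%VF = t.
  by rewrite -!comp_lfunA.
by rewrite -addrA; exact: (@mulrn3_eq0 F^o t).
Qed.

End Negligible.

(** * The functor from superspaces *)

Section FunctorF.
Variable F : fieldType.
Hypothesis char3 : 3%N \in [pchar F].
Implicit Types X Y Z : svec F.

Local Notation FF := (ssF char3).
Local Notation odd := Defs.odd.

(** Inclusions and projections for the splitting of F(X) into [even X] and two copies of [odd X].
    Index 0 is the copy on v_0, which σ moves; index 1 is the copy on the invariant vector v_1. *)
Definition ssF_inc X : 'Hom(even X, FF X) :=
  linfun (fun x => (x, 0) : FF X).

Definition ssF_oinc X (i : 'I_2) : 'Hom(odd X, FF X) :=
  linfun (fun y => (0, y ⊗ (delta_mx 0 i : V1 char3)) : FF X).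

Definition ssF_prj X : 'Hom(FF X, even X) := linfun (fun p : FF X => p.1).

Definition ssF_oprj X (i : 'I_2) : 'Hom(FF X, odd X) :=
  linfun (fun p : FF X =>
    tlift (fun (y : odd X) (t : V1 char3) => (t : 'rV_2) 0 i *: y) p.2).

Local Notation inc := (ssF_inc _).
Local Notation oinc := (ssF_oinc _).
Local Notation prj := (ssF_prj _).
Local Notation oprj := (ssF_oprj _).

Lemma ssF_incE X x : ssF_inc X x = (x, 0).
Proof.
by apply: (@linfunE _ _ (FF X)) => a u v; congr (_, _); rewrite /= scaler0 addr0.
Qed.

Lemma ssF_oincE X i y : ssF_oinc X i y = (0, y ⊗ (delta_mx 0 i : V1 char3)).
Proof.
apply: (@linfunE _ _ (FF X)) => a u v; congr (_, _).
  by rewrite /= scaler0 addr0.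
exact: tpure_linearl.
Qed.

Lemma ssF_prjE X p : ssF_prj X p = p.1.
Proof. by apply: (@linfunE _ (FF X)). Qed.

Lemma ssF_oprjE X i x y (t : V1 char3) :
  ssF_oprj X i (x, y ⊗ t) = (t : 'rV_2) 0 i *: y.
Proof.
rewrite /ssF_oprj linfunE /= => [|a p q]; last by rewrite /= linearP.
apply: (@tliftE _ _ _ _ (fun (y : odd X) (t : V1 char3) => (t : 'rV_2) 0 i *: y)).
  by move=> v a u w; rewrite scalerDr !scalerA mulrC.
by move=> u a v w; rewrite !mxE scalerDl scalerA.
Qed.

Lemma ssF_prj_inc X x : prj (ssF_inc X x) = x.
Proof. by rewrite ssF_prjE ssF_incE. Qed.

Lemma ssF_prj_oinc X i y : prj (ssF_oinc X i y) = 0.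
Proof. by rewrite ssF_prjE ssF_oincE. Qed.

Lemma ssF_oprj_inc X i x : oprj i (ssF_inc X x) = 0.
Proof.
by rewrite ssF_incE -(linear0 (@tpure _ (odd X) (V1 char3) 0)) ssF_oprjE scaler0.
Qed.

Lemma ssF_oprj_oinc X i j y : oprj i (ssF_oinc X j y) = (i == j)%:R *: y.
Proof. by rewrite ssF_oincE ssF_oprjE mxE. Qed.

Lemma ssF_split X (p : FF X) :
  p = inc (prj p) + oinc 0 (oprj 0 p) + oinc 1 (oprj 1 p).
Proof.
pose c i := tlift (fun (y : odd X) (t : V1 char3) => (t : 'rV_2) 0 i *: y).
have cE i y (t : V1 char3) : c i (y ⊗ t) = (t : 'rV_2) 0 i *: y.
  by rewrite -(ssF_oprjE i 0) /ssF_oprj linfunE // => a u v; rewrite /= linearP.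
have oprjE i : ssF_oprj X i p = c i p.2.
  by rewrite /ssF_oprj linfunE // => a u v; rewrite /= linearP.
have e : \1%VF = (tinsert _ (delta_mx 0 0 : V1 char3) \o c 0
                  + (tinsert _ (delta_mx 0 1 : V1 char3) \o c 1))%VF.
  apply: tens_hom_ext => y t; rewrite add_lfunE !comp_lfunE id_lfunE !cE.
  rewrite !tinsertE !tpureZl -!linearZ /= -linearD; congr (_ ⊗ _).
  rewrite {1}(row_sum_delta (t : 'rV_2)) !big_ord_recl big_ord0 addr0.
  by have -> : lift ord0 ord0 = 1 :> 'I_2 by apply/val_inj.
rewrite ssF_prjE ssF_incE !ssF_oincE !oprjE.
case: p oprjE => x M oprjE; congr (_, _); first by rewrite /= !addr0.
by rewrite /= add0r -{1}[M]id_lfunE e add_lfunE !comp_lfunE !tinsertE.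
Qed.

Lemma rep_gen_inc X x : rep_gen (FF X) (inc x) = inc x.
Proof.
by rewrite ssF_incE /= /ssF_gen pair_mapE /= linear0 id_lfunE.
Qed.

Lemma rep_gen_oinc X i y : rep_gen (FF X) (oinc i y) =
  oinc i y + (i == 0)%:R *: oinc 1 y.
Proof.
rewrite !ssF_oincE /= /ssF_gen pair_mapE /= linear0 tmapE V1_genE id_lfunE.
congr (_, _); first by rewrite /= scaler0 addr0.
by rewrite linearD linearZ /= mxE /= eq_sym.
Qed.

Lemma nilgen_inc X x : nilgen (FF X) (inc x) = 0.
Proof. by rewrite nilgenE rep_gen_inc subrr. Qed.

Lemma nilgen_oinc0 X y : nilgen (FF X) (oinc 0 y) = oinc 1 y.
Proof. by rewrite nilgenE rep_gen_oinc eqxx scale1r addrC addKr. Qed.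

Lemma nilgen_oinc1 X y : nilgen (FF X) (oinc 1 y) = 0.
Proof. by rewrite nilgenE rep_gen_oinc scale0r addr0 subrr. Qed.

Lemma ssF_ext X (V : vectType F) (f g : 'Hom(FF X, V)) :
  (forall x, f (inc x) = g (inc x)) ->
  (forall i y, f (oinc i y) = g (oinc i y)) -> f = g.
Proof.
move=> e0 e1; apply/lfunP => p.
by rewrite (ssF_split p) !linearD /= e0 !e1.
Qed.

Lemma ssF_tens_ext X Y (V : vectType F) (f g : 'Hom(rep_tens (FF X) (FF Y), V)) :
  (forall x y, f (inc x ⊗ inc y) = g (inc x ⊗ inc y)) ->
  (forall x i y, f (inc x ⊗ oinc i y) = g (inc x ⊗ oinc i y)) ->
  (forall i x y, f (oinc i x ⊗ inc y) = g (oinc i x ⊗ inc y)) ->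
  (forall i x j y, f (oinc i x ⊗ oinc j y) = g (oinc i x ⊗ oinc j y)) -> f = g.
Proof.
move=> e00 e01 e10 e11; apply/subr0_eq/tens_hom_ext => p q.
set h : 'Hom(tens (FF X) (FF Y), V) := f - g; rewrite zero_lfunE.
have hE p' q' : f (p' ⊗ q') = g (p' ⊗ q') -> h (p' ⊗ q') = 0.
  by move=> e; rewrite add_lfunE opp_lfunE e subrr.
have h0 x : h (inc x ⊗ q) = 0.
  by rewrite (ssF_split q) 4!linearD /= !hE ?addr0.
have h1 i x : h (oinc i x ⊗ q) = 0.
  by rewrite (ssF_split q) 4!linearD /= !hE ?addr0.
by rewrite (ssF_split p) -tinsertE 4!linearD /= !tinsertE h0 !h1 !addr0.
Qed.

Lemma ssF_resolution X :
  ((ssF_inc X \o ssF_prj X) + (ssF_oinc X 0 \o ssF_oprj X 0)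
   + (ssF_oinc X 1 \o ssF_oprj X 1))%VF = \1%VF.
Proof.
by apply/lfunP => p; rewrite !add_lfunE !comp_lfunE id_lfunE -ssF_split.
Qed.

Lemma ssF_trE X (f : 'End(FF X)) :
  lfun_tr f = lfun_tr (ssF_prj X \o (f \o ssF_inc X))%VF
    + lfun_tr (ssF_oprj X 0 \o (f \o ssF_oinc X 0))%VF
    + lfun_tr (ssF_oprj X 1 \o (f \o ssF_oinc X 1))%VF.
Proof.
rewrite -{1}[f]comp_lfun1r -(ssF_resolution X) !comp_lfunDr !linearD /=.
by congr (_ + _ + _); rewrite comp_lfunA lfun_trC.
Qed.

(** The trace of [g \o d] is computed on the three summands of F(X), where N^2 = 0 and the image of
    N is the v_1 copy. So [g \o d] kills the v_1 copy; hence it maps the v_0 copy into the kernel of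
    N, which has no v_0 component; and it maps the even part into the image of N, which has no even
    component. *)
Lemma negligible_ssF X (Y : rep F) (d : 'Hom(FF X, Y)) :
  equivariant d ->
  (forall x, exists t, d (inc x) = nilgen Y t) ->
  (forall y, exists t, d (oinc 1 y) = nilgen Y (nilgen Y t)) ->
  negligible d.
Proof.
move=> ed d0 d1 g eg; rewrite lfun_trC ssF_trE.
have N1 (p : FF X) : nilgen (FF X) p = oinc 1 (oprj 0 p).
  by rewrite {1}(ssF_split p) !linearD /= nilgen_inc nilgen_oinc0 nilgen_oinc1
    add0r addr0.
have tr0 (U : vectType F) (f : 'End(U)) : (forall x, f x = 0) -> lfun_tr f = 0.
  move=> f0; have -> : f = 0 by apply/lfunP => x; rewrite f0 zero_lfunE.
  exact: linear0.
rewrite !tr0 ?addr0 // => x; rewrite !comp_lfunE.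
- have [t ->] := d1 x; rewrite !equivariant_nilgen // !N1 !ssF_oprj_oinc.
  by rewrite !scale0r ?linear0 ?scaler0.
- set p := g _; have : nilgen (FF X) p = 0.
    rewrite /p -!equivariant_nilgen // nilgen_oinc0.
    have [t ->] := d1 x; rewrite !equivariant_nilgen // !N1 !ssF_oprj_oinc.
    by rewrite !scale0r linear0.
  by rewrite N1 => /(congr1 (oprj 1)); rewrite ssF_oprj_oinc linear0 eqxx scale1r.
- by have [t ->] := d0 x; rewrite equivariant_nilgen // N1 ssF_prj_oinc.
Qed.

Lemma ssF_mapE X Y (k : shom X Y) :
  (forall x, ssF_map char3 k (inc x) = inc (hom_even k x)) /\
  (forall i y, ssF_map char3 k (oinc i y) = oinc i (hom_odd k y)).
Proof.
split=> [x|i y]; first by rewrite !ssF_incE /ssF_map pair_mapE /= linear0.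
by rewrite !ssF_oincE /ssF_map pair_mapE /= linear0 tmapE id_lfunE.
Qed.

Lemma ssF_map_inc X Y (k : shom X Y) x :
  ssF_map char3 k (inc x) = inc (hom_even k x).
Proof. exact: (ssF_mapE k).1. Qed.

Lemma ssF_map_oinc X Y (k : shom X Y) i y :
  ssF_map char3 k (oinc i y) = oinc i (hom_odd k y).
Proof. exact: (ssF_mapE k).2. Qed.

Lemma ssF_map_comp X Y Z (f : shom X Y) (g : shom Y Z) :
  ssF_map char3 (scomp g f) = (ssF_map char3 g \o ssF_map char3 f)%VF.
Proof.
apply: ssF_ext => [x|i y]; rewrite comp_lfunE;
  by rewrite ?ssF_map_inc ?ssF_map_oinc !comp_lfunE.
Qed.

Lemma equivariant_ssF_map X Y (k : shom X Y) : equivariant (ssF_map char3 k).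
Proof.
apply: ssF_ext => [x|i y]; rewrite !comp_lfunE.
  by rewrite rep_gen_inc !ssF_map_inc rep_gen_inc.
rewrite rep_gen_oinc linearD linearZ /= !ssF_map_oinc.
by rewrite rep_gen_oinc.
Qed.

(** The preimage consists of the even diagonal block and the block from v_0 to v_0. What remains
    sends an even vector to an invariant one without even part, hence into the v_1 copy, which is
    the image of N; on the v_1 copy it vanishes because [h] commutes with N. *)
Lemma ssF_full X Y (h : 'Hom(FF X, FF Y)) : equivariant h ->
  exists k : shom X Y, ver_eq h (ssF_map char3 k).
Proof.
move=> eh.
exists (SHom (prj \o (h \o inc))%VF (oprj 0 \o (h \o oinc 0))%VF).
have N1 (p : FF Y) : nilgen (FF Y) p = oinc 1 (oprj 0 p).
  by rewrite {1}(ssF_split p) !linearD /= nilgen_inc nilgen_oinc0 nilgen_oinc1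
    add0r addr0.
apply: negligible_ssF => [|x|y].
- exact: equivariantB eh (equivariant_ssF_map _).
- rewrite add_lfunE opp_lfunE ssF_map_inc /= !comp_lfunE.
  have : nilgen (FF Y) (h (inc x)) = 0.
    by rewrite -equivariant_nilgen // nilgen_inc linear0.
  rewrite N1 => /(congr1 (oprj 1)); rewrite ssF_oprj_oinc linear0 scale1r => e.
  exists (oinc 0 (oprj 1 (h (inc x)))).
  by rewrite nilgen_oinc0 {1}(ssF_split (h (inc x))) e linear0 addr0 addrC addKr.
- exists 0; rewrite add_lfunE opp_lfunE ssF_map_oinc /= !comp_lfunE !linear0.
  by rewrite -[oinc 1 y]nilgen_oinc0 (equivariant_nilgen _ eh) N1 subrr.
Qed.

(** Testing against images of F gives the even trace plus twice the odd trace, the 2 being the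
    dimension of [V1]; choosing the other component of the test map to be zero separates the two,
    and the trace pairing is nondegenerate. *)
Lemma ssF_faithful X Y (k : shom X Y) : negligible (ssF_map char3 k) ->
  hom_even k = 0 /\ hom_odd k = 0.
Proof.
move=> nk.
have tr g : lfun_tr (hom_even k \o hom_even g)%VF
    + lfun_tr (hom_odd k \o hom_odd g)%VF
    + lfun_tr (hom_odd k \o hom_odd g)%VF = 0.
  rewrite -[RHS](nk _ (equivariant_ssF_map g)) -ssF_map_comp ssF_trE.
  congr (_ + _ + _); congr lfun_tr; apply/lfunP => x;
    rewrite ![in RHS]comp_lfunE ?ssF_map_inc ?ssF_map_oinc ?ssF_prj_inc //=;
    by rewrite ssF_oprj_oinc eqxx scale1r.
split; apply: lfun_tr_eq0 => g.
  have := tr (SHom g 0).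
  by rewrite /= comp_lfun0r !linear0 !addr0.
have := tr (SHom 0 g); rewrite /= comp_lfun0r linear0 add0r.
(* Both 2t and 3t vanish, so t does. *)
set t := lfun_tr _ => t2; have : t *+ 3 = 0 := @mulrn3_eq0 _ char3 F^o t.
by rewrite mulrS mulr2n t2 addr0.
Qed.

Lemma ssF_faithful_eq X Y (k l : shom X Y) :
  ver_eq (ssF_map char3 k) (ssF_map char3 l) -> k = l.
Proof.
case: k l => k0 k1 [l0 l1]; set k := SHom k0 k1; set l := SHom l0 l1.
have -> : @ver_eq _ (FF X) (FF Y) (ssF_map char3 k) (ssF_map char3 l)
  = negligible (ssF_map char3 (SHom (k0 - l0) (k1 - l1))).
  congr negligible; apply: ssF_ext => [x|i y]; rewrite add_lfunE opp_lfunE.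
    by rewrite !ssF_map_inc /= add_lfunE opp_lfunE linearB.
  by rewrite !ssF_map_oinc /= add_lfunE opp_lfunE linearB.
by case/ssF_faithful => /= /subr0_eq e0 /subr0_eq e1; rewrite /k /l e0 e1.
Qed.

Lemma equivariant_ssF_unit : equivariant (ssF_unit char3).
Proof.
have uE p : ssF_unit char3 p = p.1 by apply: linfunE.
by apply/equivariantE => p; rewrite !uE id_lfunE /= /ssF_gen pair_mapE /= id_lfunE.
Qed.

Lemma ssF_unit_inc a : ssF_unit char3 (ssF_inc (sunit F) a) = a.
Proof. by rewrite /ssF_unit linfunE // ssF_incE. Qed.

Lemma ssF_unitK : (ssF_inc (sunit F) \o ssF_unit char3)%VF = \1%VF.
Proof.
apply: ssF_ext => [x|i y]; rewrite !comp_lfunE id_lfunE ?ssF_unit_inc //.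
have -> : y = 0 by apply/rowP => -[].
by rewrite !linear0.
Qed.

Lemma equivariant_ssF_inc_unit :
  @equivariant _ (rep_unit F) (FF (sunit F)) (ssF_inc (sunit F)).
Proof. by apply/equivariantE => x; rewrite id_lfunE rep_gen_inc. Qed.

Lemma eq_tlift (U V W : vectType F) (b b' : U -> V -> W) :
  (forall u v, b u v = b' u v) -> tlift b = tlift b'.
Proof.
move=> bb; apply/lfunP => M; rewrite !tliftEsum.
by apply: eq_bigr => i _; apply: eq_bigr => j _; rewrite bb.
Qed.

Lemma tlift_odd X (W : vectType F) (b : odd X -> V1 char3 -> W) (p : FF X) :
  (forall t, linear (b^~ t)) -> (forall y, linear (b y)) ->
  tlift b p.2 = b (oprj 0 p) (delta_mx 0 0) + b (oprj 1 p) (delta_mx 0 1).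
Proof.
move=> bl br; have -> : p.2 = oprj 0 p ⊗ (delta_mx 0 0 : V1 char3)
    + oprj 1 p ⊗ (delta_mx 0 1 : V1 char3).
  by rewrite {1}(ssF_split p) ssF_incE !ssF_oincE /= add0r.
by rewrite linearD /= !tliftE.
Qed.

Section MonoidalStructure.
Variables X Y : svec F.
Let XY := stens X Y.

(** J in components: since λ is alternating with value 1 on v_0 ⊗ v_1, the odd-odd part contributes
    the difference of the two mixed products. *)
Let G (p : FF X) (q : FF Y) : FF XY :=
  inc ((prj p ⊗ prj q,
        oprj 0 p ⊗ oprj 1 q - oprj 1 p ⊗ oprj 0 q) : even XY)
  + oinc 0 ((prj p ⊗ oprj 0 q, oprj 0 p ⊗ prj q) : odd XY)
  + oinc 1 ((prj p ⊗ oprj 1 q, oprj 1 p ⊗ prj q) : odd XY).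

Lemma ssJ_pureE (p : FF X) (q : FF Y) : ssJ char3 X Y (p ⊗ q) = G p q.
Proof.
have -> : ssJ char3 X Y = tlift G.
  apply: eq_tlift => {}p {}q; rewrite /G ssF_incE !ssF_oincE !ssF_prjE.
  congr (_, _); last first.
    rewrite /= add0r !tlift_odd.
    - rewrite addrACA -!tinsertE -!linearD /= !tinsertE.
      by congr (_ ⊗ _ + _ ⊗ _); congr (_, _); rewrite /= ?addr0 ?add0r.
    - by move=> t a u v; rewrite -!tinsertE -linearZ -linearD; congr (tinsert _ _ _);
        congr (_, _); rewrite /= ?tinsertE ?scaler0 ?addr0 ?linearP ?tpure_linearl.
    - by move=> y a u v; rewrite linearP.
    - by move=> t a u v; rewrite -!tinsertE -linearZ -linearD; congr (tinsert _ _ _);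
        congr (_, _); rewrite /= ?tinsertE ?scaler0 ?addr0 ?linearP ?tpure_linearl.
    - by move=> y a u v; rewrite linearP.
  rewrite /= !addr0; congr (_, _).
  have e (x : odd X) (s : V1 char3) :
      tlift (fun (y : odd Y) (t : V1 char3) => lambda s t *: (x ⊗ y)) q.2
    = (s : 'rV_2) 0 0 *: (x ⊗ oprj 1 q) - (s : 'rV_2) 0 1 *: (x ⊗ oprj 0 q).
    rewrite tlift_odd.
    - rewrite /lambda !mxE /= !mulr0 !mulr1 subr0 sub0r scaleNr addrC.
      by [].
    - by move=> t a u v; rewrite linearP !scalerDr !scalerA mulrC.
    - move=> y a u v; rewrite scalerA -scalerDl /lambda !mxE; congr (_ *: _).
      by ring.
  rewrite (eq_tlift e) tlift_odd; first by
    rewrite !mxE /= !scale1r !scale0r subr0 sub0r.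
  - move=> t a u v; rewrite !tpure_linearl !scalerDr !scalerN !scalerA.
    by rewrite opprD addrACA [a * t 0 0]mulrC [a * t 0 1]mulrC.
  - move=> y a u v; rewrite !mxE !scalerDl opprD addrACA scalerBr !scalerA.
    by [].
have add6 (W : vectType F) a (x x' y y' z z' : W) :
    a *: x + x' + (a *: y + y') + (a *: z + z') = a *: (x + y + z) + (x' + y' + z').
  by rewrite !scalerDr [RHS]addrACA [X in X + _ = _]addrACA.
have incP a (A A' B : even XY) : B = a *: A + A' ->
    inc B = a *: inc A + inc A' by move=> ->; rewrite linearP.
have oincP i a (A A' B : odd XY) : B = a *: A + A' ->
    oinc i B = a *: oinc i A + oinc i A' by move=> ->; rewrite linearP.
rewrite tliftE // => [{}q|{}p] a r r'; rewrite /G.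
  rewrite -add6; congr (_ + _ + _); [apply: incP | apply: oincP | apply: oincP].
  - rewrite [prj (a *: _ + _)]linearP [oprj 0 (a *: _ + _)]linearP.
    rewrite [oprj 1 (a *: _ + _)]linearP.
    by congr (_, _); rewrite !tpure_linearl //= opprD addrACA -scalerBr.
  - by rewrite [prj (a *: _ + _)]linearP [oprj 0 (a *: _ + _)]linearP;
      congr (_, _);
      rewrite tpure_linearl.
  - by rewrite [prj (a *: _ + _)]linearP [oprj 1 (a *: _ + _)]linearP;
      congr (_, _);
      rewrite tpure_linearl.
rewrite -add6; congr (_ + _ + _); [apply: incP | apply: oincP | apply: oincP].
- rewrite [prj (a *: _ + _)]linearP [oprj 0 (a *: _ + _)]linearP.
  rewrite [oprj 1 (a *: _ + _)]linearP.
  by congr (_, _); rewrite !tpure_linearr //= opprD addrACA -scalerBr.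
- by rewrite [prj (a *: _ + _)]linearP [oprj 0 (a *: _ + _)]linearP;
    congr (_, _); rewrite tpure_linearr.
- by rewrite [prj (a *: _ + _)]linearP [oprj 1 (a *: _ + _)]linearP;
    congr (_, _); rewrite tpure_linearr.
Qed.
End MonoidalStructure.
End FunctorF.

(** * Equivariance and naturality of the monoidal structure *)

Section TensorComparison.
Variable F : fieldType.
Hypothesis char3 : 3%N \in [pchar F].
Local Notation FF := (ssF char3).
Local Notation odd := Defs.odd.
Local Notation inc := (ssF_inc char3 _).
Local Notation oinc := (ssF_oinc char3 _).
Local Notation prj := (ssF_prj char3 _).
Local Notation oprj := (ssF_oprj char3 _).

Lemma rep_gen_tensE (A B : rep F) (x : A) (y : B) :
  rep_gen (rep_tens A B) (x ⊗ y) = rep_gen A x ⊗ rep_gen B y.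
Proof. exact: tmapE. Qed.

Lemma I2P (i : 'I_2) : {i = 0} + {i = 1}.
Proof. by case: i => -[|[|//]] p; [left | right]; apply/val_inj. Qed.

Section Comparison.
Variables X Y : svec F.
Let XY := stens X Y.

Lemma ssJ_inc_inc x y :
  ssJ char3 X Y (inc x ⊗ inc y) = inc ((x ⊗ y, 0) : even XY).
Proof.
rewrite ssJ_pureE !ssF_prj_inc !ssF_oprj_inc !tpure0l subr0.
by rewrite [x ⊗ 0]linear0 !linear0 !addr0.
Qed.

Lemma ssJ_inc_oinc x i y :
  ssJ char3 X Y (inc x ⊗ oinc i y) = oinc i ((x ⊗ y, 0) : odd XY).
Proof.
rewrite ssJ_pureE ssF_prj_inc ssF_prj_oinc !ssF_oprj_inc !ssF_oprj_oinc.
rewrite !tpure0l subr0 [x ⊗ 0]linear0 !linearZ linear0 add0r.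
case: (I2P i) => -> /=.
  by rewrite scale1r scale0r linear0 addr0.
by rewrite scale1r scale0r linear0 add0r.
Qed.

Lemma ssJ_oinc_inc i x y :
  ssJ char3 X Y (oinc i x ⊗ inc y) = oinc i ((0, x ⊗ y) : odd XY).
Proof.
rewrite ssJ_pureE ssF_prj_inc ssF_prj_oinc !ssF_oprj_inc !ssF_oprj_oinc.
rewrite !tpure0l ![_ ⊗ 0]linear0 subr0 linear0 add0r !tpureZl.
case: (I2P i) => -> /=.
  by rewrite scale1r scale0r linear0 addr0.
by rewrite scale1r scale0r linear0 add0r.
Qed.

Lemma ssJ_oinc_oinc i x j y : ssJ char3 X Y (oinc i x ⊗ oinc j y) =
  ((i == 0) && (j == 1))%:R *: inc ((0, x ⊗ y) : even XY)
  - ((i == 1) && (j == 0))%:R *: inc ((0, x ⊗ y) : even XY).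
Proof.
rewrite ssJ_pureE !ssF_prj_oinc !ssF_oprj_oinc !tpure0l ![_ ⊗ 0]linear0.
rewrite !linear0 !addr0 -scalerBl -linearZ; congr (inc _).
congr (_, _); first by rewrite /= scaler0.
by case: (I2P i) => ->; case: (I2P j) => ->;
  rewrite /= ?scale1r ?scale0r ?tpure0l ?linear0 ?subr0 ?sub0r ?addr0
  ?scaleN1r ?scale1r ?scale0r.
Qed.

(** On odd-odd pairs the target is a fixed vector, and the claim is the invariance of λ under σ. *)
Lemma equivariant_ssJ :
  @equivariant _ (rep_tens (FF X) (FF Y)) (FF XY) (ssJ char3 X Y).
Proof.
apply: ssF_tens_ext => [x y|x i y|i x y|i x j y];
  rewrite !comp_lfunE rep_gen_tensE ?rep_gen_inc ?rep_gen_oinc.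
- by rewrite ssJ_inc_inc rep_gen_inc.
- by rewrite [in RHS]ssJ_inc_oinc rep_gen_oinc linearD linearZ linearD linearZ
    /= !ssJ_inc_oinc.
- rewrite [in RHS]ssJ_oinc_inc rep_gen_oinc -tinsertE linearD linearZ linearD
    linearZ /= !tinsertE.
  by rewrite !ssJ_oinc_inc.
- rewrite [in RHS]ssJ_oinc_oinc.
  have -> a b (z : even XY) : rep_gen (FF XY) (a *: inc z - b *: inc z)
      = a *: inc z - b *: inc z by rewrite -scalerBl -linearZ rep_gen_inc.
  have -> (a b : F) : (oinc i x + a *: oinc 1 x) ⊗ (oinc j y + b *: oinc 1 y)
     = oinc i x ⊗ oinc j y + b *: (oinc i x ⊗ oinc 1 y)
       + a *: (oinc 1 x ⊗ oinc j y) + (a * b) *: (oinc 1 x ⊗ oinc 1 y).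
    rewrite linearD linearZ /= -!tinsertE !linearD !linearZ /= !tinsertE.
    by rewrite scalerA addrACA !addrA.
  rewrite 3!linearD 3!linearZ /= !ssJ_oinc_oinc.
  set w := inc _; case: (I2P i) => ->; case: (I2P j) => ->;
    rewrite /= ?mulr0 ?mul0r ?mulr1 ?scale0r ?scale1r ?subr0 ?sub0r ?scaler0
      ?addr0 ?add0r ?subrr //.
Qed.

End Comparison.

Lemma ssJ_natural (X X' Y Y' : svec F) (f : shom X X') (g : shom Y Y') :
  (ssJ char3 X' Y' \o tmap (ssF_map char3 f) (ssF_map char3 g)
   = ssF_map char3 (stmap f g) \o ssJ char3 X Y)%VF.
Proof.
apply: ssF_tens_ext => [x y|x i y|i x y|i x j y];
  rewrite !comp_lfunE tmapE ?ssF_map_inc ?ssF_map_oinc.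
- by rewrite !ssJ_inc_inc ssF_map_inc /= pair_mapE /= tmapE linear0.
- by rewrite !ssJ_inc_oinc ssF_map_oinc /= pair_mapE /= tmapE linear0.
- by rewrite !ssJ_oinc_inc ssF_map_oinc /= pair_mapE /= tmapE linear0.
- rewrite !ssJ_oinc_oinc -!scalerBl; set c := _ - _.
  have incZ Z (z : even Z) : c *: inc z = inc (c *: z) by rewrite linearZ.
  rewrite !incZ ssF_map_inc; congr (inc _).
  by rewrite linearZ /= pair_mapE /= tmapE linear0.
Qed.

End TensorComparison.

(** * Invertibility of the monoidal structure modulo negligible morphisms *)

Section TensorSplitting.
Variable F : fieldType.
Hypothesis char3 : 3%N \in [pchar F].
Local Notation FF := (ssF char3).
Local Notation odd := Defs.odd.
Local Notation inc := (ssF_inc char3 _).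
Local Notation oinc := (ssF_oinc char3 _).
Local Notation prj := (ssF_prj char3 _).
Local Notation oprj := (ssF_oprj char3 _).

Lemma ssF_copair (X : svec F) (W : vectType F) (A : 'Hom(even X, W))
    (B : 'I_2 -> 'Hom(odd X, W)) :
  exists J : 'Hom(FF X, W),
    (forall x, J (inc x) = A x) /\ (forall i y, J (oinc i y) = B i y).
Proof.
exists ((A \o prj) + (B 0 \o oprj 0) + (B 1 \o oprj 1))%VF.
split=> [x|i y]; rewrite !add_lfunE !comp_lfunE.
  by rewrite ssF_prj_inc !ssF_oprj_inc !linear0 !addr0.
rewrite ssF_prj_oinc !ssF_oprj_oinc linear0 add0r.
by case: (I2P i) => ->; rewrite eqxx scale1r scale0r linear0 ?addr0 ?add0r.
Qed.

Section Splitting.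
Variables X Y : svec F.

(* Such a [J'] splits [ssJ], and [\1 - J' \o ssJ] projects onto the free
   summand [odd X ⊗ odd Y ⊗ S^2 V1]. *)
Definition ssJ_section (J' : 'Hom(FF (stens X Y), rep_tens (FF X) (FF Y))) :=
  (forall a b, J' (inc ((a, b) : even (stens X Y)))
     = tmap inc inc a + (tmap (oinc 1) (oinc 0) b - tmap (oinc 0) (oinc 1) b)) /\
  (forall i a b, J' (oinc i ((a, b) : odd (stens X Y)))
     = tmap inc (oinc i) a + tmap (oinc i) inc b).

Lemma ssJ_section_exists : exists J', ssJ_section J'.
Proof.
have linA (U V W : vectType F) (f : 'Hom(U, W)) (g : 'Hom(V, W)) :
    exists h : 'Hom((U * V)%type, W), forall a b, h (a, b) = f a + g b.
  exists (linfun (fun p : U * V => f p.1 + g p.2)) => a b.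
  by rewrite linfunE // => c p q; rewrite !linearP scalerDr addrACA.
have [A AE] := linA _ _ _ (tmap (ssF_inc char3 X) (ssF_inc char3 Y))
  (tmap (ssF_oinc char3 X 1) (ssF_oinc char3 Y 0)
   - tmap (ssF_oinc char3 X 0) (ssF_oinc char3 Y 1)).
have B i := linA _ _ _ (tmap (ssF_inc char3 X) (ssF_oinc char3 Y i))
  (tmap (ssF_oinc char3 X i) (ssF_inc char3 Y)).
have [[B0 B0E] [B1 B1E]] := (B 0, B 1).
have [J' [JA JB]] := @ssF_copair (stens X Y) _ A (fun i => if i == 0 then B0 else B1).
exists J'; split=> [a b|i a b].
  by rewrite JA AE add_lfunE opp_lfunE.
by rewrite JB; case: (I2P i) => -> /=; [exact: B0E | exact: B1E].
Qed.

Variable J' : 'Hom(FF (stens X Y), rep_tens (FF X) (FF Y)).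
Hypothesis J'P : ssJ_section J'.

Local Notation S := (rep_gen (rep_tens (FF X) (FF Y))).

(** On the odd-odd part this rests on v_1 ⊗ v_0 - v_0 ⊗ v_1 being invariant: the two terms v_1 ⊗ v_1
    created by σ cancel. *)
Lemma equivariant_ssJ_section : equivariant (J').
Proof.
have e00 a : S (tmap inc inc a) = tmap inc inc a.
  elim/tens_ind: a => [|M N eM eN|x y]; first by rewrite !lfun0E.
    by rewrite !lfunD eM eN.
  by rewrite !tmapE !rep_gen_inc.
have e01 i a : S (tmap inc (oinc i) a)
    = tmap inc (oinc i) a + (i == 0)%:R *: tmap inc (oinc 1) a.
  elim/tens_ind: a => [|M N eM eN|x y]; first by rewrite !lfun0E scaler0 addr0.
    by rewrite !lfunD scalerDr addrACA eM eN.
  by rewrite !tmapE rep_gen_oinc rep_gen_inc tpureDr linearZ.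
have e10 i a : S (tmap (oinc i) inc a)
    = tmap (oinc i) inc a + (i == 0)%:R *: tmap (oinc 1) inc a.
  elim/tens_ind: a => [|M N eM eN|x y]; first by rewrite !lfun0E scaler0 addr0.
    by rewrite !lfunD scalerDr addrACA eM eN.
  by rewrite !tmapE rep_gen_oinc rep_gen_inc tpureDl tpureZl.
have e11 b : S (tmap (oinc 1) (oinc 0) b - tmap (oinc 0) (oinc 1) b)
    = tmap (oinc 1) (oinc 0) b - tmap (oinc 0) (oinc 1) b.
  elim/tens_ind: b => [|M N eM eN|x y].
  - by rewrite !lfun0E subrr lfun0E.
  - rewrite [tmap (oinc 1) _ _]lfunD [tmap (oinc 0) _ _]lfunD opprD addrACA.
    by rewrite lfunD eM eN.
  - rewrite !tmapE lfunB !tmapE !rep_gen_oinc.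
    rewrite !eqxx !scale1r !scale0r !addr0.
    by rewrite tpureDl tpureDr opprD addrACA subrr addr0.
apply: ssF_ext => [[a b]|i [a b]]; rewrite [LHS]comp_lfunE [RHS]comp_lfunE.
  by rewrite rep_gen_inc J'P.1 lfunD e00 e11.
rewrite rep_gen_oinc !lfunD lfunZ !J'P.2 lfunD e01 e10.
by rewrite scalerDr addrACA.
Qed.

Lemma ssJ_sectionK : (ssJ char3 X Y \o J')%VF = \1%VF.
Proof.
have pairD (U V : vectType F) (M M' : U) (N N' : V) :
  (M + M', N + N') = (M, N) + (M', N') by [].
have e00 a : ssJ char3 X Y (tmap inc inc a) = inc ((a, 0) : even (stens X Y)).
  elim/tens_ind: a => [|M N eM eN|x y]; first by rewrite !lfun0E.
    by rewrite !lfunD eM eN -lfunD -pairD addr0.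
  by rewrite tmapE ssJ_inc_inc.
have e01 i a : ssJ char3 X Y (tmap inc (oinc i) a)
    = oinc i ((a, 0) : odd (stens X Y)).
  elim/tens_ind: a => [|M N eM eN|x y]; first by rewrite !lfun0E.
    by rewrite !lfunD eM eN -lfunD -pairD addr0.
  by rewrite tmapE ssJ_inc_oinc.
have e10 i b : ssJ char3 X Y (tmap (oinc i) inc b)
    = oinc i ((0, b) : odd (stens X Y)).
  elim/tens_ind: b => [|M N eM eN|x y]; first by rewrite !lfun0E.
    by rewrite !lfunD eM eN -lfunD -pairD addr0.
  by rewrite tmapE ssJ_oinc_inc.
have e11 b : ssJ char3 X Y (tmap (oinc 1) (oinc 0) b - tmap (oinc 0) (oinc 1) b)
    = inc ((0, b) : even (stens X Y)).
  rewrite lfunB; elim/tens_ind: b => [|M N eM eN|x y].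
  - by rewrite !lfun0E subr0.
  - by rewrite !lfunD opprD addrACA eM eN -lfunD -pairD addr0.
  (* λ takes the value -2 on v_1 ⊗ v_0 - v_0 ⊗ v_1, which is 1 in characteristic 3. *)
  - rewrite !tmapE !ssJ_oinc_oinc; set w := ssF_inc _ _ _.
    rewrite /= !scale0r !scale1r sub0r subr0; apply/eqP.
    rewrite -subr_eq0 -!opprD oppr_eq0.
    by rewrite -addrA -mulr2n -mulrS mulrn3_eq0.
apply: ssF_ext => [[a b]|i [a b]]; rewrite comp_lfunE id_lfunE.
  by rewrite J'P.1 [LHS]lfunD e00 e11 -lfunD -pairD addr0 add0r.
by rewrite J'P.2 [LHS]lfunD e01 e10 -lfunD -pairD addr0 add0r.
Qed.

Let T := rep_tens (FF X) (FF Y).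

(** Moves the copy of [odd X] with index [i] to index 0 and kills the rest. *)
Let oshift i : 'End(FF X) := (ssF_oinc char3 X 0 \o ssF_oprj char3 X i)%VF.
Let oshift' i : 'End(FF Y) := (ssF_oinc char3 Y 0 \o ssF_oprj char3 Y i)%VF.

(** The defect is the projection onto the blocks of size 3 generated by the tensors over v_0 ⊗ v_0.
    It is written as the trace map of an explicit [phi], hence is negligible. *)
Lemma ssJ_section_ver : @ver_eq _ T T (J' \o ssJ char3 X Y)%VF \1%VF.
Proof.
(* On odd-odd tensors [phi] sends v_i ⊗ v_j to -(v_0 ⊗ v_0), except v_0 ⊗ v_0, which it kills. The
   sign is chosen because N^2 (v_0 ⊗ v_0) = 2 v_1 ⊗ v_1 = -(v_1 ⊗ v_1). *)
have [phi [phi0l phi0r phiE]] : exists phi : 'End(T),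
    [/\ forall x q, phi (inc x ⊗ q) = 0, forall q y, phi (q ⊗ inc y) = 0
      & forall i x j y, phi (oinc i x ⊗ oinc j y)
         = - ((i == 1) || (j == 1))%:R *: (oinc 0 x ⊗ oinc 0 y)].
  exists (- (tmap (oshift 0) (oshift' 1) + tmap (oshift 1) (oshift' 0)
             + tmap (oshift 1) (oshift' 1))).
  have E p q : (- (tmap (oshift 0) (oshift' 1) + tmap (oshift 1) (oshift' 0)
             + tmap (oshift 1) (oshift' 1))) (p ⊗ q) =
     - (oinc 0 (oprj 0 p) ⊗ oinc 0 (oprj 1 q) +
        oinc 0 (oprj 1 p) ⊗ oinc 0 (oprj 0 q) +
        oinc 0 (oprj 1 p) ⊗ oinc 0 (oprj 1 q)).
    by rewrite opp_lfunE !add_lfunE !tmapE !comp_lfunE.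
  split=> [x q|p y|i x j y]; rewrite E ?ssF_oprj_inc ?ssF_oprj_oinc.
  - by rewrite !lfun0E !tpure0l !addr0 oppr0.
  - by rewrite !lfun0E ![_ ⊗ 0]linear0 !addr0 oppr0.
  - case: (I2P i) => ->; case: (I2P j) => ->;
      rewrite /= ?scale1r ?scale0r ?lfun0E ?tpure0l ?[_ ⊗ 0]linear0 ?addr0 ?add0r;
      by rewrite ?scaleNr ?scale1r ?scale0r ?oppr0 ?scaler0.
pose N := nilgen T.
have Nii x y : N (inc x ⊗ inc y) = 0.
  by rewrite nilgenE rep_gen_tensE !rep_gen_inc subrr.
have Nio x i y : N (inc x ⊗ oinc i y) = (i == 0)%:R *: (inc x ⊗ oinc 1 y).
  by rewrite nilgenE rep_gen_tensE rep_gen_inc rep_gen_oinc tpureDr linearZ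
    addrC addKr.
have Noi i x y : N (oinc i x ⊗ inc y) = (i == 0)%:R *: (oinc 1 x ⊗ inc y).
  by rewrite nilgenE rep_gen_tensE rep_gen_inc rep_gen_oinc tpureDl tpureZl
    addrC addKr.
have N00 x y : N (oinc 0 x ⊗ oinc 0 y)
    = oinc 0 x ⊗ oinc 1 y + oinc 1 x ⊗ oinc 0 y + oinc 1 x ⊗ oinc 1 y.
  rewrite nilgenE rep_gen_tensE !rep_gen_oinc eqxx !scale1r.
  by rewrite tpureDl !tpureDr addrC -[_ + _ + (_ + _)]addrA addKr addrA.
have N01 x y : N (oinc 0 x ⊗ oinc 1 y) = oinc 1 x ⊗ oinc 1 y.
  rewrite nilgenE rep_gen_tensE !rep_gen_oinc eqxx scale1r scale0r addr0.
  by rewrite tpureDl addrC addKr.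
have N10 x y : N (oinc 1 x ⊗ oinc 0 y) = oinc 1 x ⊗ oinc 1 y.
  rewrite nilgenE rep_gen_tensE !rep_gen_oinc eqxx scale1r scale0r addr0.
  by rewrite tpureDr addrC addKr.
have N11 x y : N (oinc 1 x ⊗ oinc 1 y) = 0.
  by rewrite nilgenE rep_gen_tensE !rep_gen_oinc !scale0r !addr0 subrr.
suff -> : (J' \o ssJ char3 X Y)%VF = \1%VF - ((N \o (N \o phi))
    + (N \o (phi \o N)) + (phi \o (N \o N)))%VF.
  rewrite /ver_eq addrAC subrr sub0r; apply: negligibleN.
  exact: negligible_nilgen2.
have trE (L : 'End(T)) p : (\1%VF - ((N \o (N \o L))
    + (N \o (L \o N)) + (L \o (N \o N)))%VF) p
    = p - (N (N (L p)) + N (L (N p)) + L (N (N p))).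
  by rewrite add_lfunE opp_lfunE 2!add_lfunE 6!comp_lfunE id_lfunE.
apply: ssF_tens_ext => [x y|x i y|i x y|i x j y]; rewrite trE comp_lfunE.
- rewrite phi0l !Nii !lfun0E !addr0 subr0 ssJ_inc_inc J'P.1.
  by rewrite !lfun0E subr0 addr0 tmapE.
- rewrite phi0l Nio !lfunZ !(phi0l, Nio, lfunZ, scale0r, scaler0, lfun0E, addr0, subr0).
  by rewrite ssJ_inc_oinc J'P.2 lfun0E addr0 tmapE.
- rewrite phi0r Noi !lfunZ !(phi0r, Noi, lfunZ, scale0r, scaler0, lfun0E, addr0, subr0).
  by rewrite ssJ_oinc_inc J'P.2 lfun0E add0r tmapE.
- have J'0 : J' (inc ((0, x ⊗ y) : even (stens X Y)))
      = oinc 1 x ⊗ oinc 0 y - oinc 0 x ⊗ oinc 1 y.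
    by rewrite J'P.1 lfun0E add0r !tmapE.
  rewrite ssJ_oinc_oinc -scalerBl lfunZ J'0.
  have three (v : tens (FF X) (FF Y)) : v + v + v = 0.
    by rewrite -addrA -mulr2n -mulrS mulrn3_eq0.
  have two (v : tens (FF X) (FF Y)) : v + v = - v.
    by apply/eqP; rewrite -addr_eq0 three.
  have pa : phi (oinc 0 x ⊗ oinc 0 y) = 0 by rewrite phiE oppr0 scale0r.
  have pb : phi (oinc 0 x ⊗ oinc 1 y) = - (oinc 0 x ⊗ oinc 0 y).
    by rewrite phiE scaleN1r.
  have pc : phi (oinc 1 x ⊗ oinc 0 y) = - (oinc 0 x ⊗ oinc 0 y).
    by rewrite phiE scaleN1r.
  have pd : phi (oinc 1 x ⊗ oinc 1 y) = - (oinc 0 x ⊗ oinc 0 y).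
    by rewrite phiE scaleN1r.
  have NNa : N (N (oinc 0 x ⊗ oinc 0 y)) = - (oinc 1 x ⊗ oinc 1 y).
    by rewrite N00 !lfunD N01 N10 N11 addr0 two.
  have pN : phi (N (oinc 0 x ⊗ oinc 0 y)) = 0.
    by rewrite N00 2!lfunD pb pc pd three.
  have lfunN (f : 'End(T)) v : f (- v) = - f v by exact: linearN.
  case: (I2P i) => ->; case: (I2P j) => ->; rewrite /= ?subr0 ?sub0r ?subrr
    ?scale0r ?scale1r ?scaleN1r ?opprB.
  - by rewrite pa pN NNa lfunN pd opprK !lfun0E !add0r subrr.
  - rewrite pb N01 N11 pd lfun0E !lfunN NNa N00 opprK addr0 opprD opprK.
    by rewrite (addrC (_ + _) (oinc 1 x ⊗ oinc 1 y)) addKr addrA two addrC.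
  - rewrite pc N10 N11 pd lfun0E !lfunN NNa N00 opprK addr0 opprD opprK.
    by rewrite (addrC (_ + _) (oinc 1 x ⊗ oinc 1 y)) addKr addrCA two.
  - by rewrite pd N11 !lfun0E !lfunN NNa opprK !addr0 subrr.
Qed.

End Splitting.

End TensorSplitting.

(** * Uniqueness of the semisimplification *)

Section VerCalculus.
Variable F : fieldType.
Implicit Types X Y Z : rep F.

Lemma ver_eq_compl X Y Z (f f' : 'Hom(X, Y)) (g : 'Hom(Y, Z)) :
  equivariant g -> ver_eq f f' -> @ver_eq _ X Z (g \o f)%VF (g \o f')%VF.
Proof.
by move=> eg ff'; rewrite /ver_eq -comp_lfunNr -comp_lfunDr; apply: negligible_compl.
Qed.

Lemma ver_eq_compr X Y Z (f : 'Hom(X, Y)) (g g' : 'Hom(Y, Z)) :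
  equivariant f -> ver_eq g g' -> @ver_eq _ X Z (g \o f)%VF (g' \o f)%VF.
Proof.
by move=> ef gg'; rewrite /ver_eq -comp_lfunNl -comp_lfunDl; apply: negligible_compr.
Qed.

Lemma ver_eq_cancelr X Y Z (j : 'Hom(X, Y)) (j' : 'Hom(Y, X)) (a b : 'Hom(Y, Z)) :
  equivariant j' -> (j \o j')%VF = \1%VF ->
  @ver_eq _ X Z (a \o j)%VF (b \o j)%VF -> ver_eq a b.
Proof.
move=> ej' jj' /(ver_eq_compr ej').
by rewrite -!comp_lfunA jj' !comp_lfun1r.
Qed.

(** * Transport of products and forms between two models of one object *)

Section Transport.
Variables (A B B' : rep F).
Variables (f : 'Hom(B, A)) (f' : 'Hom(B', A)) (g' : 'Hom(A, B')) (k : 'Hom(B, B')).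
Hypotheses (ef : equivariant f) (ef' : equivariant f') (eg' : equivariant g').
Hypothesis (ek : equivariant k).
Hypotheses (gf' : @ver_eq _ B' B' (g' \o f')%VF \1%VF).
Hypotheses (fg' : @ver_eq _ A A (f' \o g')%VF \1%VF).
Hypothesis hk : @ver_eq _ B B' (g' \o f)%VF k.

Lemma ver_eq_transport : @ver_eq _ B A (f' \o k)%VF f.
Proof.
apply: (@ver_eq_trans _ B A _ ((f' \o g') \o f)%VF).
  by rewrite -comp_lfunA; apply: ver_eq_compl => //; apply: ver_eq_sym.
by rewrite -[X in ver_eq _ X]comp_lfun1l; apply: ver_eq_compr.
Qed.

Lemma ver_eq_transport2 :
  @ver_eq _ (rep_tens B B) (rep_tens A A) (tmap f' f' \o tmap k k)%VF (tmap f f).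
Proof.
rewrite tmap_comp; apply: ver_eq_tmap ver_eq_transport ver_eq_transport => //.
exact: equivariant_comp ek ef'.
Qed.

(** Modulo negligible morphisms, [k \o Q] is [g' \o f \o Q], then [g' \o mu \o tmap f f], then
    [g' \o mu \o tmap f' f' \o tmap k k], then [g' \o f' \o Q' \o tmap k k], and [g' \o f'] is the
    identity. *)
Lemma ver_eq_transport_mul (mu : 'Hom(rep_tens A A, A)) (Q : 'Hom(rep_tens B B, B))
    (Q' : 'Hom(rep_tens B' B', B')) :
  equivariant mu -> equivariant Q -> equivariant Q' ->
  @ver_eq _ (rep_tens B B) A (f \o Q)%VF (mu \o tmap f f)%VF ->
  @ver_eq _ (rep_tens B' B') A (f' \o Q')%VF (mu \o tmap f' f')%VF ->
  @ver_eq _ (rep_tens B B) B' (k \o Q)%VF (Q' \o tmap k k)%VF.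
Proof.
move=> emu eQ eQ' fQ fQ'.
have ekk := equivariant_tmap ek ek.
apply: (@ver_eq_trans _ (rep_tens B B) B' _ (g' \o (mu \o tmap f f))%VF).
  apply: (@ver_eq_trans _ (rep_tens B B) B' _ ((g' \o f) \o Q)%VF).
    exact: ver_eq_compr eQ (ver_eq_sym hk).
  by rewrite -comp_lfunA; apply: (@ver_eq_compl (rep_tens B B)).
apply: (@ver_eq_trans _ (rep_tens B B) B' _ (g' \o (mu \o (tmap f' f' \o tmap k k)))%VF).
  apply: (@ver_eq_compl (rep_tens B B)) eg' _.
  exact: (@ver_eq_compl _ (rep_tens A A)) emu (ver_eq_sym ver_eq_transport2).
apply: (@ver_eq_trans _ (rep_tens B B) B' _ (g' \o ((f' \o Q') \o tmap k k))%VF).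
  apply: (@ver_eq_compl (rep_tens B B)) eg' _; rewrite comp_lfunA.
  exact: (@ver_eq_compr (rep_tens B B) (rep_tens B' B')) ekk (ver_eq_sym fQ').
rewrite -comp_lfunA comp_lfunA -[X in ver_eq _ X]comp_lfun1l.
exact: (@ver_eq_compr (rep_tens B B)) (equivariant_comp ekk eQ') gf'.
Qed.

Lemma ver_eq_transport_form (n : 'Hom(rep_tens A A, rep_unit F))
    (Q : 'Hom(rep_tens B B, rep_unit F)) (Q' : 'Hom(rep_tens B' B', rep_unit F)) :
  equivariant n ->
  @ver_eq _ (rep_tens B B) (rep_unit F) Q (n \o tmap f f)%VF ->
  @ver_eq _ (rep_tens B' B') (rep_unit F) Q' (n \o tmap f' f')%VF ->
  @ver_eq _ (rep_tens B B) (rep_unit F) Q (Q' \o tmap k k)%VF.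
Proof.
move=> en fQ fQ'; have ekk := equivariant_tmap ek ek.
apply: ver_eq_trans fQ _.
apply: (@ver_eq_trans _ (rep_tens B B) _ _ (n \o (tmap f' f' \o tmap k k))%VF).
  exact: (@ver_eq_compl _ (rep_tens A A)) en (ver_eq_sym ver_eq_transport2).
rewrite comp_lfunA.
exact: (@ver_eq_compr (rep_tens B B) (rep_tens B' B')) ekk (ver_eq_sym fQ').
Qed.

End Transport.
End VerCalculus.

(** * Lifting an equivalence of semisimplifications to superspaces *)

Section Uniqueness.
Variable F : fieldType.
Hypothesis char3 : 3%N \in [pchar F].
Local Notation FF := (ssF char3).
Local Notation odd := Defs.odd.
Local Notation inc := (ssF_inc char3 _).
Local Notation oinc := (ssF_oinc char3 _).
Local Notation Fm := (ssF_map char3).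
Local Notation J := (ssJ char3).

(** The section [J'] of J reduces the criterion to maps out of a single F(X ⊗ Y). The last condition
    is the value of [d] over the invariant vector v_1 ⊗ v_0 - v_0 ⊗ v_1. *)
Lemma negligible_ssF_tens (X Y : svec F) (Z : rep F)
    (d : 'Hom(rep_tens (FF X) (FF Y), Z)) :
  equivariant d ->
  (forall x y, exists t, d (inc x ⊗ inc y) = nilgen Z t) ->
  (forall x y, exists t, d (inc x ⊗ oinc 1 y) = nilgen Z (nilgen Z t)) ->
  (forall x y, exists t, d (oinc 1 x ⊗ inc y) = nilgen Z (nilgen Z t)) ->
  (forall x y, exists t,
    d (oinc 1 x ⊗ oinc 0 y) - d (oinc 0 x ⊗ oinc 1 y) = nilgen Z t) ->
  negligible d.
Proof.
move=> ed dee deo doe doo; have [J' J'P] := ssJ_section_exists char3 X Y.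
have tens_ex (U V W : vectType F) (f : 'Hom(tens U V, Z)) (N : 'Hom(W, Z)) :
    (forall u v, exists t, f (u ⊗ v) = N t) -> forall M, exists t, f M = N t.
  move=> fN M; elim/tens_ind: M => [|M M' [t eM] [t' eM']|//].
    by exists 0; rewrite !lfun0E.
  by exists (t + t'); rewrite !lfunD eM eM'.
(* [d] differs from [d \o J' \o J] by a negligible map, because [J' \o J] is the identity modulo
   negligible morphisms. *)
suff nd : negligible (d \o J')%VF.
  have := negligible_compr (equivariant_ssJ char3 X Y) nd.
  have := negligible_compl (ver_eq_sym (ssJ_section_ver J'P)) ed.
  move=> n1 n2; have := negligibleD n1 n2.
  by rewrite comp_lfunDr comp_lfunNr comp_lfun1r comp_lfunA subrK.
apply: negligible_ssF => [|[a b]|[a b]].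
- exact: equivariant_comp (equivariant_ssJ_section J'P) ed.
- rewrite comp_lfunE J'P.1 lfunD.
  have [|t] := tens_ex _ _ _ (d \o tmap (ssF_inc char3 X) (ssF_inc char3 Y))%VF
    (nilgen Z) _ a; first by move=> u v; rewrite comp_lfunE tmapE.
  rewrite comp_lfunE => ->.
  have [|t'] := tens_ex _ _ _ (d \o (tmap (ssF_oinc char3 X 1) (ssF_oinc char3 Y 0)
    - tmap (ssF_oinc char3 X 0) (ssF_oinc char3 Y 1)))%VF (nilgen Z) _ b.
    by move=> u v; rewrite comp_lfunE add_lfunE opp_lfunE !tmapE lfunB.
  rewrite comp_lfunE add_lfunE opp_lfunE => ->.
  by exists (t + t'); rewrite lfunD.
- rewrite comp_lfunE J'P.2 lfunD.
  have [|t] := tens_ex _ _ _ (d \o tmap (ssF_inc char3 X) (ssF_oinc char3 Y 1))%VF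
    (nilgen Z \o nilgen Z)%VF _ a.
    by move=> u v; have [t e] := deo u v; exists t; rewrite !comp_lfunE tmapE.
  rewrite 2!comp_lfunE => ->.
  have [|t'] := tens_ex _ _ _ (d \o tmap (ssF_oinc char3 X 1) (ssF_inc char3 Y))%VF
    (nilgen Z \o nilgen Z)%VF _ b.
    by move=> u v; have [t' e] := doe u v; exists t'; rewrite !comp_lfunE tmapE.
  rewrite 2!comp_lfunE => ->.
  by exists (t + t'); rewrite !lfunD.
Qed.

Definition shom_id (X : svec F) : shom X X := SHom \1%VF \1%VF.

Lemma ssF_map_id X : Fm (shom_id X) = \1%VF.
Proof.
by apply: ssF_ext => [x|i y]; rewrite ?ssF_map_inc ?ssF_map_oinc !id_lfunE.
Qed.

(** J has the equivariant right inverse [J'], and F is faithful. *)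
Lemma ssF_map_J_inj (X Y Z : svec F) (a b : shom (stens X Y) Z) :
  @ver_eq _ (rep_tens (FF X) (FF Y)) (FF Z) (Fm a \o J X Y)%VF (Fm b \o J X Y)%VF ->
  a = b.
Proof.
move=> ab; apply: (@ssF_faithful_eq _ char3).
have [J' J'P] := ssJ_section_exists char3 X Y.
exact: ver_eq_cancelr (equivariant_ssJ_section J'P) (ssJ_sectionK J'P) ab.
Qed.

Section TwoSemisimplifications.
Variables (A : rep F) (mu : 'Hom(rep_tens A A, A)).
Variables (n : 'Hom(rep_tens A A, rep_unit F)).
Hypotheses (emu : equivariant mu) (en : equivariant n).

(** Fullness lifts [g' \o f] and [g \o f'] to maps [k] and [k'] of superspaces. Faithfulness turns
    the relations modulo negligible morphisms into true equations: [k] and [k'] are mutually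
    inverse, and [k] respects product and form. *)
Lemma semisimplification_unique (S T : superalgebra F) :
  is_semisimplification char3 mu n S -> is_semisimplification char3 mu n T ->
  superalgebra_iso S T.
Proof.
move=> [f [g [[ef eg] [gf fg] fmu fn]]] [f' [g' [[ef' eg'] [gf' fg'] fmu' fn']]].
pose h : 'Hom(FF S, FF T) := (g' \o f)%VF.
pose h' : 'Hom(FF T, FF S) := (g \o f')%VF.
have eh : equivariant h by exact: equivariant_comp ef eg'.
have eh' : equivariant h' by exact: equivariant_comp ef' eg.
have [k hk] := ssF_full eh; have [k' hk'] := ssF_full eh'.
have eFk : equivariant (Fm k) by exact: equivariant_ssF_map.
have eFk' : equivariant (Fm k') by exact: equivariant_ssF_map.
have k'k : scomp k' k = shom_id S.
  apply: (@ssF_faithful_eq _ char3); rewrite ssF_map_comp ssF_map_id.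
  apply: ver_eq_trans gf.
  apply: (@ver_eq_trans _ _ _ _ (h' \o Fm k)%VF).
    exact: ver_eq_compr eFk (ver_eq_sym hk').
  rewrite -comp_lfunA; apply: ver_eq_compl eg _.
  exact: ver_eq_transport ef ef' fg' hk.
have kk' : scomp k k' = shom_id T.
  apply: (@ssF_faithful_eq _ char3); rewrite ssF_map_comp ssF_map_id.
  apply: ver_eq_trans gf'.
  apply: (@ver_eq_trans _ _ _ _ (h \o Fm k')%VF).
    exact: ver_eq_compr eFk' (ver_eq_sym hk).
  rewrite -comp_lfunA; apply: ver_eq_compl eg' _.
  exact: ver_eq_transport ef' ef fg hk'.
have eJ (X : svec F) (a : shom (stens X X) X) :
    @equivariant _ (rep_tens (FF X) (FF X)) (FF X) (Fm a \o J X X)%VF.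
  exact: equivariant_comp (equivariant_ssJ _ _ _) (equivariant_ssF_map _ _).
exists k; split.
- case: k' k {hk hk' eFk eFk'} k'k kk' => [k'0 k'1] [k0 k1] [e0 _] [e1 _] /=.
  by exists k'0 => x; rewrite -comp_lfunE ?e0 ?e1 id_lfunE.
- case: k' k {hk hk' eFk eFk'} k'k kk' => [k'0 k'1] [k0 k1] [_ e0] [_ e1] /=.
  by exists k'1 => x; rewrite -comp_lfunE ?e0 ?e1 id_lfunE.
- apply: ssF_map_J_inj; rewrite (ssF_map_comp _ (sa_mul S)) (ssF_map_comp _ (stmap k k)).
  rewrite -2!comp_lfunA -ssJ_natural (comp_lfunA _ (J T T)).
  have H := ver_eq_transport_mul ef ef' eg' eFk gf' fg' hk emu (eJ _ _) (eJ _ _) fmu fmu'.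
  exact: H.
- apply: ssF_map_J_inj; rewrite (ssF_map_comp _ (stmap k k)) -comp_lfunA -ssJ_natural.
  have nST := ver_eq_transport_form ef ef' eFk fg' hk en fn fn'.
  (* The inverse of [ssF_unit] carries the relation from the trivial representation to the image of
     the unit object, where faithfulness applies. *)
  have := @ver_eq_compl _ (rep_tens (FF S) (FF S)) (rep_unit F) (FF (sunit F))
    _ _ _ (equivariant_ssF_inc_unit char3) nST.
  rewrite -!(comp_lfunA (ssF_unit char3)) !(comp_lfunA (ssF_inc char3 (sunit F))).
  by rewrite ssF_unitK !comp_lfun1l -!comp_lfunA.
Qed.

End TwoSemisimplifications.
End Uniqueness.

(** * Semisimplification from a Jordan decomposition *)

Section Decomposition.
Variable F : fieldType.

Lemma equivariant_of_nilgen (X Y : rep F) (f : 'Hom(X, Y)) :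
  (forall x, f (nilgen X x) = nilgen Y (f x)) -> equivariant f.
Proof.
move=> fN; apply/equivariantE => x; have := fN x.
by rewrite !nilgenE lfunB => /addIr.
Qed.

Lemma lfun_inj_inverse (U V : vectType F) (f : 'Hom(U, V)) :
  (forall u, f u = 0 -> u = 0) -> \dim {:U} = \dim {:V} ->
  exists g : 'Hom(V, U), cancel f g /\ cancel g f.
Proof.
move=> f0 dUV; exists (f^-1)%VF.
have kf : lker f == 0%VS.
  rewrite -subv0; apply/subvP => u; rewrite memv_ker => /eqP/f0 ->.
  exact: mem0v.
split=> [|v]; first exact: lker0_lfunK.
apply: limg_lfunVK; suff /eqP -> : limg f == fullv by rewrite memvf.
have dl : \dim (limg f) = \dim {:U} by apply: limg_dim_eq; rewrite (eqP kf) capv0.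
by rewrite eqEdim subvf -dUV dl /=.
Qed.

Lemma linfun_pairE (U V W : vectType F) (f : 'Hom(U, W)) (g : 'Hom(V, W)) a b :
  linfun (fun p : U * V => f p.1 + g p.2) (a, b) = f a + g b.
Proof. by rewrite linfunE // => c p q; rewrite !linearP scalerDr addrACA. Qed.

Hypothesis char3 : 3%N \in [pchar F].
Local Notation FF := (ssF char3).
Local Notation odd := Defs.odd.

Variables (A : rep F) (E O P : vectType F).
Variables (f0 : 'Hom(E, A)) (f1 : 'Hom(O, A)) (f2 : 'Hom(P, A)).
Local Notation N := (nilgen A).
Hypothesis Nf0 : forall x, N (f0 x) = 0.
Hypothesis NNf1 : forall y, N (N (f1 y)) = 0.
Hypothesis socle_inj : forall x y p, f0 x + N (f1 y) + N (N (f2 p)) = 0 ->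
  [/\ x = 0, y = 0 & p = 0].
Hypothesis dimA : (\dim {:E} + 2 * \dim {:O} + 3 * \dim {:P} = \dim {:A})%N.

Local Notation glue x y y' p p' p'' :=
  (f0 x + f1 y + N (f1 y') + (f2 p + N (f2 p') + N (N (f2 p'')))).

Lemma nilgen_glue x y y' p p' p'' :
  N (glue x y y' p p' p'') = glue 0 0 y 0 p p'.
Proof. by rewrite !lfunD Nf0 NNf1 nilgen3 // !lfun0E !addr0 !add0r. Qed.

(** Independence of the block bottoms gives that of whole blocks: applying N twice isolates [p],
    applying it once then isolates [y] and [p'], and the equation itself the rest. *)
Lemma glue_inj x y y' p p' p'' : glue x y y' p p' p'' = 0 ->
  [/\ x = 0, y = 0 & y' = 0] /\ [/\ p = 0, p' = 0 & p'' = 0].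
Proof.
move=> e0; have e1 := nilgen_glue x y y' p p' p''.
rewrite e0 lfun0E in e1; have e2 := nilgen_glue 0 0 y 0 p p'.
rewrite -e1 lfun0E in e2.
have [_ _ p0] : [/\ 0 = 0 :> E, 0 = 0 :> O & p = 0].
  by apply: (socle_inj (etrans _ (esym e2))); rewrite !lfun0E !addr0 !add0r.
have [_ y0 p'0] : [/\ 0 = 0 :> E, y = 0 & p' = 0].
  by apply: (socle_inj (etrans _ (esym e1))); rewrite p0 !lfun0E !addr0 !add0r.
have [x0 y'0 p''0] : [/\ x = 0, y' = 0 & p'' = 0].
  apply: (socle_inj (etrans _ e0)).
  by rewrite p0 y0 p'0 !lfun0E !addr0 !add0r.
by [].
Qed.

(** The gluing map is injective between spaces of equal dimension; the coordinates are the
    components of its inverse. *)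
Lemma decomposition_coords : exists
   (cx : 'Hom(A, E)) (cy cy' : 'Hom(A, O)) (cp cp' cp'' : 'Hom(A, P)),
  (forall v, v = glue (cx v) (cy v) (cy' v) (cp v) (cp' v) (cp'' v)) /\
  (forall v, [/\ cx (N v) = 0, cy (N v) = 0 & cy' (N v) = cy v]) /\
  (forall v, [/\ cp (N v) = 0, cp' (N v) = cp v & cp'' (N v) = cp' v]) /\
  (forall x y y', let v := glue x y y' 0 0 0 in
     [/\ cx v = x, cy v = y & cy' v = y']).
Proof.
pose U : vectType F := (E * O * O * (P * P * P))%type.
pose b (u : U) := glue u.1.1.1 u.1.1.2 u.1.2 u.2.1.1 u.2.1.2 u.2.2.
pose B : 'Hom(U, A) := linfun b.
have bE u : B u = b u.
  have add3 a (x x' y y' z z' : A) :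
      a *: x + x' + (a *: y + y') + (a *: z + z')
      = a *: (x + y + z) + (x' + y' + z').
    by rewrite !scalerDr [RHS]addrACA [X in X + _ = _]addrACA.
  apply: linfunE => a v w; rewrite /b /= !(lfunD, lfunZ) !add3.
  by rewrite addrACA -scalerDr.
have Bker u : B u = 0 -> u = 0.
  case: u => [[[x y] y'] [[p p'] p'']]; rewrite bE => /glue_inj /=.
  by case=> -[-> -> ->] [-> -> ->].
have dimU : \dim {:U} = \dim {:A}.
  rewrite -dimA !dimvf.
  have -> : dim U = (dim E + dim O + dim O + (dim P + dim P + dim P))%N by [].
  by lia.
have [G [GK KG]] := lfun_inj_inverse Bker dimU.
pose c (W : vectType F) (pr : U -> W) : 'Hom(A, W) := linfun (fun v => pr (G v)).
have cE (W : vectType F) (pr : U -> W) : linear pr -> forall v, c W pr v = pr (G v).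
  by move=> lp; apply: linfunE => a v w; rewrite linearP lp.
exists (c E (fun u => u.1.1.1)), (c O (fun u => u.1.1.2)), (c O (fun u => u.1.2)).
exists (c P (fun u => u.2.1.1)), (c P (fun u => u.2.1.2)), (c P (fun u => u.2.2)).
split=> [v|]; first by rewrite !cE // -[LHS]KG bE.
have GN v : G (N v) = (0, 0, (G v).1.1.2, (0, (G v).2.1.1, (G v).2.1.2)).
  by rewrite -{1}[v]KG bE /b nilgen_glue -[X in G X](bE (_, _, _, (_, _, _))) GK.
split=> [v|]; first by rewrite !cE // GN.
split=> [v|x y y' v]; first by rewrite !cE // GN.
rewrite !cE //.

by rewrite /v -[X in G X](bE (_, _, _, (_, _, _))) GK.
Qed.

(** [f] embeds the blocks of size 1 and 2, and [g] forgets those of size 3. *)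
Lemma ssF_decomposition (X := SVec E O) : exists (f : 'Hom(FF X, A)) (g : 'Hom(A, FF X)),
  [/\ equivariant f /\ equivariant g, (g \o f)%VF = \1%VF,
      @ver_eq _ A A (f \o g)%VF \1%VF,
      forall x, f (ssF_inc char3 X x) = f0 x
    & forall y, f (ssF_oinc char3 X 0 y) = f1 y /\ f (ssF_oinc char3 X 1 y) = N (f1 y)].
Proof.
have [cx [cy [cy' [cp [cp' [cp'' [cE [cN [cNp cK]]]]]]]]] := decomposition_coords.
have [f [fi fo]] := @ssF_copair _ char3 X _ f0
  (fun i => if i == 0 then f1 else (N \o f1)%VF).
have fo0 y : f (ssF_oinc char3 X 0 y) = f1 y by rewrite fo.
have fo1 y : f (ssF_oinc char3 X 1 y) = N (f1 y) by rewrite fo comp_lfunE.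
pose g : 'Hom(A, FF X) := ((ssF_inc char3 X \o cx) + (ssF_oinc char3 X 0 \o cy)
   + (ssF_oinc char3 X 1 \o cy'))%VF.
have gE v : g v = ssF_inc char3 X (cx v) + ssF_oinc char3 X 0 (cy v)
   + ssF_oinc char3 X 1 (cy' v) by rewrite 2!add_lfunE 3!comp_lfunE.
exists f, g; split=> //.
- split; [apply: equivariant_of_nilgen => p | apply: equivariant_of_nilgen => v].
    rewrite (ssF_split p) !lfunD nilgen_inc nilgen_oinc0 nilgen_oinc1.
    by rewrite fi fo0 !fo1 Nf0 NNf1 lfun0E.
  rewrite !gE !lfunD nilgen_inc nilgen_oinc0 nilgen_oinc1.
  by have [-> -> ->] := cN v; rewrite !lfun0E !add0r addr0.
- apply: ssF_ext => [x|i y]; rewrite comp_lfunE id_lfunE gE.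
    have [] := cK x 0 0; rewrite !lfun0E !addr0 -fi => -> -> ->.
    by rewrite !lfun0E !addr0.
  case: (I2P i) => ->.
    have [] := cK 0 y 0; rewrite !lfun0E !addr0 add0r -fo0 => -> -> ->.
    by rewrite !lfun0E addr0 add0r.
  have [] := cK 0 0 y; rewrite !lfun0E !addr0 !add0r -fo1 => -> -> ->.
  by rewrite !lfun0E !add0r.
(* The projection onto the blocks of size 3 is the trace map of [f2 \o cp'']: since N shifts the
   coordinates, the three terms restore the components along N^2, N and 1. *)
- suff -> : (f \o g)%VF = \1%VF - ((N \o (N \o (f2 \o cp''))) +
      (N \o ((f2 \o cp'') \o N)) + ((f2 \o cp'') \o (N \o N)))%VF.
    rewrite /ver_eq addrAC subrr sub0r; apply: negligibleN.
    exact: negligible_nilgen2.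
  apply/lfunP => v; rewrite comp_lfunE add_lfunE opp_lfunE id_lfunE.
  rewrite 2!add_lfunE !comp_lfunE.
  have [_ eN' eN''] := cNp v; have [_ eNN' eNN''] := cNp (N v).
  rewrite eNN'' eN'' eN' gE !lfunD fi fo0 fo1; apply: (canRL (addrK _)).
  by rewrite [RHS]cE; congr (_ + _); rewrite addrC [X in _ + X]addrC addrA.
Qed.

(** * Product and form read off the decomposition *)

Variables (m : A -> A -> A) (n : A -> A -> F^o).
Hypotheses (ml : forall v, linear (m^~ v)) (mr : forall u, linear (m u)).
Hypotheses (nl : forall v, linear (n^~ v)) (nr : forall u, linear (n u)).
Hypothesis mS : forall x y, rep_gen A (m x y) = m (rep_gen A x) (rep_gen A y).
Hypothesis nS : forall x y, n (rep_gen A x) (rep_gen A y) = n x y.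

Variables (m00 : E -> E -> E) (m01 : E -> O -> O) (m10 : O -> E -> O).
Variables (m11 : O -> O -> E) (n0 : E -> E -> F^o) (n1 : O -> O -> F^o).
Hypotheses (m00l : forall v, linear (m00^~ v)) (m00r : forall u, linear (m00 u)).
Hypotheses (m01l : forall v, linear (m01^~ v)) (m01r : forall u, linear (m01 u)).
Hypotheses (m10l : forall v, linear (m10^~ v)) (m10r : forall u, linear (m10 u)).
Hypotheses (m11l : forall v, linear (m11^~ v)) (m11r : forall u, linear (m11 u)).
Hypotheses (n0l : forall v, linear (n0^~ v)) (n0r : forall u, linear (n0 u)).
Hypotheses (n1l : forall v, linear (n1^~ v)) (n1r : forall u, linear (n1 u)).

Hypothesis m00E : forall x y, f0 (m00 x y) = m (f0 x) (f0 y).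
Hypothesis m01E : forall x y, N (f1 (m01 x y)) = m (f0 x) (N (f1 y)).
Hypothesis m10E : forall x y, N (f1 (m10 x y)) = m (N (f1 x)) (f0 y).
(* The invariant vector of [V1 ⊗ V1] on which [lambda] takes the value 1 is
   [v1 ⊗ v0 - v0 ⊗ v1]. *)
Hypothesis m11E : forall x y, exists t,
  f0 (m11 x y) - (m (N (f1 x)) (f1 y) - m (f1 x) (N (f1 y))) = N t.
Hypothesis n0E : forall x y, n0 x y = n (f0 x) (f0 y).
Hypothesis n01E : forall x y, n (f0 x) (N (f1 y)) = 0.
Hypothesis n10E : forall x y, n (N (f1 x)) (f0 y) = 0.
Hypothesis n1E : forall x y,
  n1 x y = n (N (f1 x)) (f1 y) - n (f1 x) (N (f1 y)).

(** The hypotheses on the products and forms are exactly the conditions of [negligible_ssF_tens] for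
    the two defects, for the product and for the form. *)
Theorem is_semisimplification_of_decomposition :
  is_semisimplification char3 (tlift m) (tlift n)
    (superalgebra_of m00 m01 m10 m11 n0 n1).
Proof.
set S := superalgebra_of _ _ _ _ _ _.
have [f [g [[ef eg] gf fg fi fo]]] := ssF_decomposition.
have fo0 y := (fo y).1; have fo1 y := (fo y).2.
have mulE00 x y : hom_even (sa_mul S) (x ⊗ y, 0) = m00 x y.
  by rewrite /= linfun_pairE lfun0E addr0 tliftE.
have mulE11 x y : hom_even (sa_mul S) (0, x ⊗ y) = m11 x y.
  by rewrite /= linfun_pairE lfun0E add0r tliftE.
have mulE01 x y : hom_odd (sa_mul S) (x ⊗ y, 0) = m01 x y.
  by rewrite /= linfun_pairE lfun0E addr0 tliftE.
have mulE10 x y : hom_odd (sa_mul S) (0, x ⊗ y) = m10 x y.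
  by rewrite /= linfun_pairE lfun0E add0r tliftE.
have formE00 x y : hom_even (sa_form S) (x ⊗ y, 0) = n0 x y.
  by rewrite /= linfun_pairE lfun0E addr0 tliftE.
have formE11 x y : hom_even (sa_form S) (0, x ⊗ y) = n1 x y.
  by rewrite /= linfun_pairE lfun0E add0r tliftE.
have formE1 x : hom_odd (sa_form S) x = 0 by exact: zero_lfunE.
(* Needed because J has coefficient -2 on v_1 ⊗ v_0 - v_0 ⊗ v_1. *)
have two (W : lmodType F) (w : W) : - w - w = w.
  apply/eqP; rewrite -subr_eq0 -!opprD oppr_eq0 -addrA -mulr2n -mulrS.
  by rewrite mulrn3_eq0.
pose X := SVec E O.
have ef' : forall p, f (rep_gen (FF X) p) = rep_gen A (f p) by apply/equivariantE.
exists f, g; split=> //; first by split=> //; rewrite gf; apply: ver_eq_refl.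
- pose d : 'Hom(rep_tens (FF X) (FF X), A) :=
    (f \o (ssF_map char3 (sa_mul S) \o ssJ char3 X X))%VF - (tlift m \o tmap f f)%VF.
  have dE p q : d (p ⊗ q)
       = f (ssF_map char3 (sa_mul S) (ssJ char3 X X (p ⊗ q))) - m (f p) (f q).
    by rewrite add_lfunE opp_lfunE !comp_lfunE tmapE (tliftE ml mr).
  change (@negligible _ (rep_tens (FF X) (FF X)) A d).
  apply: negligible_ssF_tens => [|x y|x y|x y|x y]; rewrite ?dE.
  - apply: equivariantB.
      apply: equivariant_comp ef.
      exact: equivariant_comp (equivariant_ssJ _ _ _) (equivariant_ssF_map _ _).
    apply: tens_hom_ext => p q.
    by rewrite !comp_lfunE rep_gen_tensE !tmapE !ef' !(tliftE ml mr) mS.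
  - exists 0; rewrite ssJ_inc_inc ssF_map_inc mulE00 !fi m00E.
    by rewrite subrr lfun0E.
  - exists 0; rewrite ssJ_inc_oinc ssF_map_oinc mulE01 !fi !fo1 m01E.
    by rewrite subrr !lfun0E.
  - exists 0; rewrite ssJ_oinc_inc ssF_map_oinc mulE10 !fi !fo1 m10E.
    by rewrite subrr !lfun0E.
  - have [t tE] := m11E x y; exists t; rewrite -tE.
    rewrite !ssJ_oinc_oinc !fo0 !fo1 -!scalerBl !lfunZ ssF_map_inc mulE11 fi.
    by rewrite /= sub0r subr0 scaleN1r scale1r opprD addrACA two -opprD.
- pose d : 'Hom(rep_tens (FF X) (FF X), rep_unit F) :=
    (ssF_unit char3 \o (ssF_map char3 (sa_form S) \o ssJ char3 X X))%VF
    - (tlift n \o tmap f f)%VF.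
  have dE p q : d (p ⊗ q) = ssF_unit char3
      (ssF_map char3 (sa_form S) (ssJ char3 X X (p ⊗ q))) - n (f p) (f q).
    by rewrite add_lfunE opp_lfunE !comp_lfunE tmapE (tliftE nl nr).
  change (@negligible _ (rep_tens (FF X) (FF X)) (rep_unit F) d).
  (* N is zero on the trivial representation, so here the four conditions are equalities. *)
  apply: negligible_ssF_tens => [|x y|x y|x y|x y]; rewrite ?dE.
  - apply: equivariantB.
      apply: equivariant_comp (equivariant_ssF_unit char3).
      exact: equivariant_comp (equivariant_ssJ _ _ _) (equivariant_ssF_map _ _).
    apply: tens_hom_ext => p q.
    by rewrite !comp_lfunE rep_gen_tensE !tmapE !ef' !(tliftE nl nr) nS id_lfunE.
  - exists 0; rewrite ssJ_inc_inc ssF_map_inc ssF_unit_inc formE00 !fi n0E.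
    by rewrite subrr lfun0E.
  - exists 0; rewrite ssJ_inc_oinc ssF_map_oinc formE1 fi fo1 n01E.
    by rewrite subr0 !lfun0E.
  - exists 0; rewrite ssJ_oinc_inc ssF_map_oinc formE1 fi fo1 n10E.
    by rewrite subr0 !lfun0E.
  - exists 0; rewrite !ssJ_oinc_oinc !fo0 !fo1 -!scalerBl !lfunZ ssF_map_inc.
    rewrite ssF_unit_inc formE11 lfun0E /= sub0r subr0 scaleN1r scale1r opprD.
    by rewrite addrACA two n1E -opprD subrr.
Qed.
End Decomposition.

(** * Coordinates in the split Cayley algebra *)

Section CompositionAlgebra.
Variables (F : fieldType) (C : composition_algebra F).
Local Notation M := (ca_mul C).
Local Notation pol := (polar (@ca_norm F C)).

Lemma polarC x y : pol x y = pol y x.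
Proof. by rewrite /polar [y + x]addrC addrAC. Qed.

Lemma polarDr x y z : pol x (y + z) = pol x y + pol x z.
Proof. by have := ca_polar_linear x 1 y z; rewrite scale1r mul1r. Qed.

Lemma polar0r x : pol x 0 = 0.
Proof. by apply: (addrI (pol x 0)); rewrite -polarDr !addr0. Qed.

Lemma polarZr a x y : pol x (a *: y) = a * pol x y.
Proof. by have := ca_polar_linear x a y 0; rewrite addr0 polar0r addr0. Qed.

Lemma polarDl x y z : pol (x + y) z = pol x z + pol y z.
Proof. by rewrite polarC polarDr !(polarC z). Qed.

Lemma polarZl a x y : pol (a *: x) y = a * pol x y.
Proof. by rewrite polarC polarZr polarC. Qed.

Lemma polarxx x : pol x x = 2%:R * ca_norm x.
Proof.
by rewrite /polar -mulr2n -scaler_nat ca_normZ; ring.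
Qed.

Lemma ca_mulDr x y z : M x (y + z) = M x y + M x z.
Proof. exact: linearDr. Qed.
Lemma ca_mulDl x y z : M (x + y) z = M x z + M y z.
Proof. exact: linearDl. Qed.
Lemma ca_mulZr a x y : M x (a *: y) = a *: M x y.
Proof. exact: linearZr. Qed.
Lemma ca_mulZl a x y : M (a *: x) y = a *: M x y.
Proof. exact: linearZl. Qed.

Lemma ca_mul_linearl y : linear (M^~ y).
Proof. by move=> a x z; rewrite ca_mulDl ca_mulZl. Qed.
Lemma ca_mul_linearr x : linear (M x).
Proof. by move=> a y z; rewrite ca_mulDr ca_mulZr. Qed.

Lemma polar_linearl y : linear ((pol : C -> C -> F^o)^~ y).
Proof. by move=> a x z; rewrite polarDl polarZl. Qed.
Lemma polar_linearr x : linear (pol x : C -> F^o).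
Proof. by move=> a y z; rewrite polarDr polarZr. Qed.

Hypothesis char3 : 3%N \in [pchar F].
Variables (s : 'End(C)) (s_aut : is_automorphism s).
Hypothesis s3 : (s \o s \o s)%VF = \1%VF.

Lemma polar_aut x y : pol (s x) (s y) = pol x y.
Proof. by case: s_aut => _ _ ns; rewrite /polar -lfunD !ns. Qed.

(** Uniqueness reduces each case to exhibiting one semisimplification; product and polar form are
    equivariant because [s] is an automorphism. *)
Lemma ca_semisimplification_isoP (T : superalgebra F) :
  ca_semisimplification char3 s3 T -> ca_semisimplification_iso char3 s3 T.
Proof.
move=> ssT; split=> [|S ssS]; first by exists T.
apply: semisimplification_unique ssS ssT; apply: tens_hom_ext => x y;
  rewrite !comp_lfunE rep_gen_tensE /=.
  rewrite !(tliftE ca_mul_linearl ca_mul_linearr).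
  by case: s_aut => _ ->.
by rewrite !(tliftE polar_linearl polar_linearr) polar_aut id_lfunE.
Qed.

End CompositionAlgebra.

(* [phi] is a bare function here, because rewriting with the linearity of a
   canonical [{scalar W}] is very slow on large sums. *)
Lemma scalar_ext (F : fieldType) (W : vectType F) (w w' : W) :
  (forall phi : W -> F,
     (forall x y, phi (x + y) = phi x + phi y) -> (forall x, phi (- x) = - phi x) ->
     (forall a x, phi (a *: x) = a * phi x) -> phi w = phi w') ->
  w = w'.
Proof.
move=> e; rewrite (coord_vbasis (memvf w)) (coord_vbasis (memvf w')).
apply: eq_bigr => i _; congr (_ *: _); apply: e => [x y|x|a x].
- exact: linearD.
- exact: linearN.
- exact: linearZ.
Qed.

Section Coordinates.
Variables (F : fieldType) (C : composition_algebra F).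
Local Notation M := (ca_mul C).
Local Notation pol := (polar (@ca_norm F C)).
Variables (e1 e2 : C) (u v : 'I_3 -> C).
Hypothesis cb : canonical_basis e1 e2 u v.

(** With this notation identities in the algebra become polynomial identities in eight coordinates,
    proved by [congr cvec] and [ring]. *)
Definition cvec (x y a b c d e f : F) : C :=
  x *: e1 + y *: e2 + a *: u 0 + b *: u 1 + c *: u 2%:R
  + d *: v 0 + e *: v 1 + f *: v 2%:R.

Let i01 : 0 + 1 = 1 :> 'I_3. Proof. exact/val_inj. Qed.
Let i11 : 1 + 1 = 2%:R :> 'I_3. Proof. exact/val_inj. Qed.
Let i21 : 2%:R + 1 = 0 :> 'I_3. Proof. exact/val_inj. Qed.
Let i02 : 0 + 2%:R = 2%:R :> 'I_3. Proof. exact/val_inj. Qed.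
Let i12 : 1 + 2%:R = 0 :> 'I_3. Proof. exact/val_inj. Qed.
Let i22 : 2%:R + 2%:R = 1 :> 'I_3. Proof. exact/val_inj. Qed.

Lemma canonical_basis_uu :
  [/\ M (u 0) (u 1) = v 2%:R, M (u 1) (u 2%:R) = v 0 & M (u 2%:R) (u 0) = v 1] /\
  [/\ M (u 1) (u 0) = - v 2%:R, M (u 2%:R) (u 1) = - v 0 & M (u 0) (u 2%:R) = - v 1].
Proof.
have e := cb_uu cb; have eN := cb_uuN cb.
have := (e 0, e 1, e 2%:R, eN 0, eN 1, eN 2%:R).
by rewrite i01 i11 i21 i02 i12 i22 => -[[[[[-> ->] ->] ->] ->] ->].
Qed.

Lemma canonical_basis_vv :
  [/\ M (v 0) (v 1) = u 2%:R, M (v 1) (v 2%:R) = u 0 & M (v 2%:R) (v 0) = u 1] /\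
  [/\ M (v 1) (v 0) = - u 2%:R, M (v 2%:R) (v 1) = - u 0 & M (v 0) (v 2%:R) = - u 1].
Proof.
have e := cb_vv cb; have eN := cb_vvN cb.
have := (e 0, e 1, e 2%:R, eN 0, eN 1, eN 2%:R).
by rewrite i01 i11 i21 i02 i12 i22 => -[[[[[-> ->] ->] ->] ->] ->].
Qed.

(** This is the product of Zorn's vector matrices: dot products on the diagonal, cross products off
    it. *)
Lemma cvecM x y a b c d e f x' y' a' b' c' d' e' f' :
  M (cvec x y a b c d e f) (cvec x' y' a' b' c' d' e' f') =
  cvec (x * x' - (a * d' + b * e' + c * f'))
       (y * y' - (d * a' + e * b' + f * c'))
       (x * a' + a * y' + (e * f' - f * e'))
       (x * b' + b * y' + (f * d' - d * f'))
       (x * c' + c * y' + (d * e' - e * d'))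
       (y * d' + d * x' + (b * c' - c * b'))
       (y * e' + e * x' + (c * a' - a * c'))
       (y * f' + f * x' + (a * b' - b * a')).
Proof.
have [[u01 u12 u20] [u10 u21 u02]] := canonical_basis_uu.
have [[v01 v12 v20] [v10 v21 v02]] := canonical_basis_vv.
have uvE i j : M (u i) (v j) = (- (i == j)%:R) *: e1 by rewrite scaleNr (cb_uv cb).
have vuE i j : M (v i) (u j) = (- (i == j)%:R) *: e2 by rewrite scaleNr (cb_vu cb).
rewrite {1}/cvec !ca_mulDl !ca_mulZl.
(* Applying an arbitrary linear form makes the identity one between scalars, within reach of
   [ring]. *)
apply: scalar_ext => phi phiD phiN phiZ; rewrite {1 2 3 4 5 6 7 8}/cvec.
have phi0 : phi 0 = 0 by rewrite -(scale0r 0) phiZ mul0r.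
rewrite !ca_mulDr !ca_mulZr.
rewrite (cb_idem1 cb) (cb_idem2 cb) (cb_e12 cb) (cb_e21 cb) !(cb_e1u cb) !(cb_ue2 cb).
rewrite !(cb_e2v cb) !(cb_ve1 cb) !(cb_e2u cb) !(cb_ue1 cb) !(cb_e1v cb) !(cb_ve2 cb).
rewrite u01 u12 u20 u10 u21 u02 v01 v12 v20 v10 v21 v02 !(cb_u2 cb) !(cb_v2 cb).
rewrite !uvE !vuE /cvec !(phiD, phiZ, phiN, phi0) /=.
ring.
Qed.

Lemma cvec_polar x y a b c d e f x' y' a' b' c' d' e' f' :
  pol (cvec x y a b c d e f) (cvec x' y' a' b' c' d' e' f') =
  x * y' + y * x' + (a * d' + b * e' + c * f') + (d * a' + e * b' + f * c').
Proof.
have pe i : pol (u i) (u i) = 0 by rewrite polarxx (cb_nu cb) mulr0.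
have pf i : pol (v i) (v i) = 0 by rewrite polarxx (cb_nv cb) mulr0.
have p1 : pol e1 e1 = 0 by rewrite polarxx (cb_ne1 cb) mulr0.
have p2 : pol e2 e2 = 0 by rewrite polarxx (cb_ne2 cb) mulr0.
have p21 : pol e2 e1 = 1 by rewrite polarC (cb_ne1e2 cb).
have pu1 i : pol (u i) e1 = 0 by rewrite polarC (cb_ne1u cb).
have pu2 i : pol (u i) e2 = 0 by rewrite polarC (cb_ne2u cb).
have pv1 i : pol (v i) e1 = 0 by rewrite polarC (cb_ne1v cb).
have pv2 i : pol (v i) e2 = 0 by rewrite polarC (cb_ne2v cb).
have pvu i j : pol (v i) (u j) = (i == j)%:R by rewrite polarC (cb_nuv cb) eq_sym.
have puu i j : pol (u i) (u j) = 0 by have [->|/(cb_nuu cb)] := eqVneq i j.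
have pvv i j : pol (v i) (v j) = 0 by have [->|/(cb_nvv cb)] := eqVneq i j.
rewrite /cvec !polarDl !polarDr !polarZl !polarZr.
rewrite p1 p2 p21 (cb_ne1e2 cb) !(cb_ne1u cb) !(cb_ne1v cb) !(cb_ne2u cb) !(cb_ne2v cb).
rewrite !pu1 !pu2 !pv1 !pv2 !puu !pvv !pvu !(cb_nuv cb) /=.
ring.
Qed.

Lemma cvecD x y a b c d e f x' y' a' b' c' d' e' f' :
  cvec x y a b c d e f + cvec x' y' a' b' c' d' e' f' =
  cvec (x + x') (y + y') (a + a') (b + b') (c + c') (d + d') (e + e') (f + f').
Proof.
apply: scalar_ext => phi phiD _ phiZ.
by rewrite /cvec !(phiD, phiZ); ring.
Qed.

Lemma cvecZ k x y a b c d e f : k *: cvec x y a b c d e f =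
  cvec (k * x) (k * y) (k * a) (k * b) (k * c) (k * d) (k * e) (k * f).
Proof. by rewrite /cvec !scalerDr !scalerA. Qed.

Lemma cvecB x y a b c d e f x' y' a' b' c' d' e' f' :
  cvec x y a b c d e f - cvec x' y' a' b' c' d' e' f' =
  cvec (x - x') (y - y') (a - a') (b - b') (c - c') (d - d') (e - e') (f - f').
Proof. by rewrite -scaleN1r cvecZ cvecD !mulN1r. Qed.

Lemma cvec0 : cvec 0 0 0 0 0 0 0 0 = 0.
Proof. by rewrite /cvec !scale0r !addr0. Qed.

(** Pairing with the dual vector of the canonical basis under the norm extracts each coordinate. *)
Lemma cvec_eq0 x y a b c d e f : cvec x y a b c d e f = 0 ->
  [/\ x = 0, y = 0, a = 0 & b = 0] /\ [/\ c = 0, d = 0, e = 0 & f = 0].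
Proof.
move=> c0; have p (w : C) : pol (cvec x y a b c d e f) w = 0.
  by rewrite c0 polarC polar0r.
have := (p (cvec 0 1 0 0 0 0 0 0), p (cvec 1 0 0 0 0 0 0 0),
  p (cvec 0 0 0 0 0 1 0 0), p (cvec 0 0 0 0 0 0 1 0), p (cvec 0 0 0 0 0 0 0 1),
  p (cvec 0 0 1 0 0 0 0 0), p (cvec 0 0 0 1 0 0 0 0), p (cvec 0 0 0 0 1 0 0 0)).
rewrite !cvec_polar !(mulr0, mulr1, addr0, add0r).
by case=> -[[[[[[[-> ->] ->] ->] ->] ->] ->] ->].
Qed.

Lemma cvec_surj w : exists x y a b c d e f, w = cvec x y a b c d e f.
Proof.
have wb : w \in span [:: e1; e2; u 0; u 1; u 2%:R; v 0; v 1; v 2%:R].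
  by rewrite (span_basis (cb_basis cb)) memvf.
have span_consP (y : C) Y (z : C) : z \in <<y :: Y>>%VS ->
    exists k, z - k *: y \in <<Y>>%VS.
  rewrite span_cons => /memv_addP[_ /vlineP[k ->] [t tY ->]].
  by exists k; rewrite addrC addKr.
have [x /span_consP[y /span_consP[a /span_consP[b /span_consP[c /span_consP[d
  /span_consP[e /span_consP[f]]]]]]]] := span_consP _ _ _ wb.
rewrite span_nil memv0 => /eqP w0; exists x, y, a, b, c, d, e, f.
by apply/eqP; rewrite -subr_eq0 /cvec !opprD !addrA w0.
Qed.

Lemma cvec_scalar (phi : C -> F) (phiD : forall x y, phi (x + y) = phi x + phi y)
    (phiZ : forall a x, phi (a *: x) = a * phi x) x y a b c d e f :
  phi (cvec x y a b c d e f) = x * phi e1 + y * phi e2 + a * phi (u 0)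
    + b * phi (u 1) + c * phi (u 2%:R) + d * phi (v 0) + e * phi (v 1)
    + f * phi (v 2%:R).
Proof. by rewrite /cvec !(phiD, phiZ). Qed.

Lemma cvec_e1 : e1 = cvec 1 0 0 0 0 0 0 0.
Proof. by rewrite /cvec !scale0r scale1r !addr0. Qed.
Lemma cvec_e2 : e2 = cvec 0 1 0 0 0 0 0 0.
Proof. by rewrite /cvec !scale0r scale1r !addr0 add0r. Qed.
Lemma cvec_u0 : u 0 = cvec 0 0 1 0 0 0 0 0.
Proof. by rewrite /cvec !scale0r scale1r !addr0 !add0r. Qed.
Lemma cvec_u1 : u 1 = cvec 0 0 0 1 0 0 0 0.
Proof. by rewrite /cvec !scale0r scale1r !addr0 !add0r. Qed.

(** An automorphism is known from the images of the three vectors [u i]: the [v i] are products of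
    these, and [e1], [e2] are up to sign the two products of [u 2%:R] and [v 2%:R]. *)
Lemma cvec_aut (s : 'End(C)) x y a b c d e f : is_automorphism s ->
  let v0 := M (s (u 1)) (s (u 2%:R)) in
  let v1 := M (s (u 2%:R)) (s (u 0)) in
  let v2 := M (s (u 0)) (s (u 1)) in
  s (cvec x y a b c d e f) =
    (- x) *: M (s (u 2%:R)) v2 + (- y) *: M v2 (s (u 2%:R))
    + a *: s (u 0) + b *: s (u 1) + c *: s (u 2%:R) + d *: v0 + e *: v1 + f *: v2.
Proof.
case=> _ sM _ v0 v1 v2; have [[u01 u12 u20] _] := canonical_basis_uu.
have uvE : M (u 2%:R) (v 2%:R) = - e1 by rewrite (cb_uv cb) eqxx scale1r.
have vuE : M (v 2%:R) (u 2%:R) = - e2 by rewrite (cb_vu cb) eqxx scale1r.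
rewrite /v0 /v1 /v2 -!sM u01 u12 u20 uvE vuE /cvec !lfunD !lfunZ.
have lfunN w : s (- w) = - s w by exact: linearN.
by rewrite !lfunN !scalerN !scaleNr !opprK.
Qed.
End Coordinates.
Arguments cvec_scalar {F C e1 e2 u v phi}.

Global Opaque cvec.

(** * The semisimplifications of the split Cayley algebra *)

Section Plane.
Variables (F : fieldType) (V : vectType F) (form : {biscalar V}).
Hypothesis dimV : \dim {:V} = 2%N.
Hypothesis form_alt : forall w : V, form w w = 0.
Hypothesis form_neq0 : exists w1 w2 : V, form w1 w2 != 0.

Definition plane_coords (b0 b1 : V) (p q : V -> F) (k : F) : Prop :=
  [/\ k != 0, scalar p /\ scalar q,
      (forall w, w = p w *: b0 + q w *: b1) /\
      [/\ p b0 = 1, q b0 = 0, p b1 = 0 & q b1 = 1],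
      forall w w', form w w' = k * (p w * q w' - q w * p w')
    & forall f : 'End(V),
        lfun_tr f = p (f b0) + q (f b1) /\
        lfun_det f = p (f b0) * q (f b1) - q (f b0) * p (f b1)].

Lemma plane_coords_exist : exists b0 b1 p q k, plane_coords b0 b1 p q k.
Proof.
(* The dimension is 2 only propositionally, so the expansions of sums and determinants are stated
   for a variable [n] first. *)
have ord2 n : n = 2%N -> exists i j : 'I_n, i != j /\
   (forall (W : nmodType) (f : 'I_n -> W), \sum_l f l = f i + f j) /\
   (forall M : 'M[F]_n, \det M = M i i * M j j - M i j * M j i).
  move=> ->; exists 0, 1; split=> //; split=> [W f|M].
    by rewrite !big_ord_recl big_ord0 addr0; congr (_ + f _); apply/val_inj.
  rewrite (expand_det_row _ 0) !big_ord_recl big_ord0 /cofactor !det_mx11 !mxE.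
  have -> : lift 0 0 = 1 :> 'I_2 by apply/val_inj.
  have -> : lift 1 0 = 0 :> 'I_2 by apply/val_inj.
  by rewrite /= expr0 expr1 mul1r addr0 mulN1r mulrN.
have [i [j [nij [sumE detE]]]] := ord2 _ dimV.
pose b := vbasis {:V}.
have wE w : w = coord b i w *: b`_i + coord b j w *: b`_j.
  by rewrite {1}(coord_vbasis (memvf w)) sumE.
have formN x y : form x y = - form y x.
  apply/eqP; rewrite -addr_eq0; have := form_alt (x + y).
  by rewrite linearDl !linearDr /= !form_alt add0r addr0 addrC => ->.
have formE w w' : form w w'
    = form b`_i b`_j * (coord b i w * coord b j w' - coord b j w * coord b i w').
  rewrite {1}(wE w) {1}(wE w') linearDl !linearDr /= !linearZl_LR !linearZr_LR /=.
  by rewrite !form_alt (formN b`_j) /=; ring.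
exists b`_i, b`_j, (coord b i), (coord b j), (form b`_i b`_j); split=> //.
- have [w1 [w2]] := form_neq0; rewrite formE; apply: contraNneq => ->.
  by rewrite mul0r.
- by split=> a x y; rewrite linearP.
- split=> //; rewrite !coord_free ?(basis_free (vbasisP _)) // !eqxx.
  by rewrite (negPf nij) eq_sym (negPf nij).
- by move=> f; rewrite lfun_trE sumE /lfun_det detE !lfun_mxE.
Qed.

End Plane.

Lemma regular_scaleE (F : fieldType) (a : F) (b : F^o) : a *: b = a * b.
Proof. by []. Qed.

Lemma scalar_funZ (F : fieldType) (V : vectType F) (f : V -> F) :
  scalar f -> forall a w, f (a *: w) = a * f w.
Proof.
move=> fl a w; have f0 : f 0 = 0.
  by have := fl (-1) 0 0; rewrite scaler0 addr0 mulN1r addNr.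
by have := fl a w 0; rewrite f0 !addr0.
Qed.

Lemma scalar_funD (F : fieldType) (V : vectType F) (f : V -> F) :
  scalar f -> forall x y, f (x + y) = f x + f y.
Proof. by move=> fl x y; have := fl 1 x y; rewrite scale1r mul1r. Qed.

(** * The cases with an explicit action on a canonical basis *)

Section SplitCayley.
Variables (F : fieldType) (C : composition_algebra F).
Hypothesis char3 : 3%N \in [pchar F].
Variables (s : 'End(C)) (s_aut : is_automorphism s).
Hypothesis s3 : (s \o s \o s)%VF = \1%VF.
Variables (e1 e2 : C) (u v : 'I_3 -> C).
Hypothesis cb : canonical_basis e1 e2 u v.
Hypothesis dimC : \dim {:C} = 8%N.
Variables (V : vectType F) (form : {biscalar V}).
Hypothesis dimV : \dim {:V} = 2%N.
Variables (b0 b1 : V) (p q : V -> F) (k : F).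
Hypothesis pqP : plane_coords form b0 b1 p q k.
Local Notation cv := (cvec e1 e2 u v).
Local Notation N := (nilgen (Rep s3)).
Local Notation M := (ca_mul C).
Local Notation pol := (polar (@ca_norm F C)).

Lemma plane_coords_eq0 w : p w = 0 -> q w = 0 -> w = 0.
Proof.
by case: pqP => _ _ [wE _] _ _ p0 q0; rewrite (wE w) p0 q0 !scale0r addr0.
Qed.

Section CaseB12.
(* [t] is 0 in part (3) of the theorem and 1 in part (4). *)
Variable t : F.
Hypotheses (su0 : s (u 0) = u 0) (su1 : s (u 1) = u 1).
Hypothesis su2 : s (u 2%:R) = cv (-1) 1 0 t 1 0 0 1.

Lemma nilgen_cvec_B12 x y a b c d e f : N (cv x y a b c d e f) =
  cv (- c) c (- e) (d + t * c) 0 0 0 (c - x + y - t * e).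
Proof.
rewrite nilgenE /= (cvec_aut cb) // su0 su1 su2.
rewrite (cvec_u0 e1 e2 u v) (cvec_u1 e1 e2 u v) !(cvecM cb).
apply: scalar_ext => phi phiD phiN phiZ.
rewrite !phiD !phiN !phiZ !(cvec_scalar phiD phiZ).
ring.

Qed.

(* The blocks of [s] are the line of the unity, two blocks of size 2 generated
   by [v 0] and [v 1], and one of size 3 generated by [u 2%:R]; the scalars are
   dictated by [form b0 b1 = k]. *)
Let f0 : 'Hom(F^o, C) := linfun (fun a : F^o => cv a a 0 0 0 0 0 0).
Let f1 : 'Hom(V, C) := linfun (fun w => cv 0 0 0 0 0 (p w) (- (k * q w)) 0).
Let f2 : 'Hom(F^o, C) := linfun (fun a : F^o => cv 0 0 0 0 a 0 0 0).

Let f0E a : f0 a = cv a a 0 0 0 0 0 0.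
Proof.
by apply: linfunE => b x y; rewrite cvecZ cvecD; congr cvec; rewrite ?mulr0 ?addr0.
Qed.

Let f1E w : f1 w = cv 0 0 0 0 0 (p w) (- (k * q w)) 0.
Proof.
have [_ [pl ql] _ _ _] := pqP.
by apply: linfunE => b x y; rewrite cvecZ cvecD pl ql; congr cvec; ring.
Qed.

Let f2E a : f2 a = cv 0 0 0 0 a 0 0 0.
Proof.
by apply: linfunE => b x y; rewrite cvecZ cvecD; congr cvec; rewrite ?mulr0 ?addr0.
Qed.

Let Nf1 w : N (f1 w) = cv 0 0 (k * q w) (p w) 0 0 0 (t * (k * q w)).
Proof. by rewrite f1E nilgen_cvec_B12; congr cvec; ring. Qed.

Lemma semisimplification_B12 : ca_semisimplification char3 s3 (B12 form).
Proof.
have [k0 [pl ql] _ formE _] := pqP.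
apply: (@is_semisimplification_of_decomposition _ char3 (Rep s3) F^o V F^o f0 f1 f2).
- by move=> a; rewrite f0E nilgen_cvec_B12 -[RHS](cvec0 e1 e2 u v); congr cvec; ring.
- by move=> w; rewrite Nf1 nilgen_cvec_B12 -[RHS](cvec0 e1 e2 u v); congr cvec; ring.
- move=> a w b; rewrite f0E Nf1 f2E !nilgen_cvec_B12 !cvecD => /(cvec_eq0 cb).
  rewrite !(mulr0, mul0r, oppr0, addr0, add0r, subr0, opprK).
  case=> -[-> _ kq0 pw0] [_ _ _].
  have qw0 : q w = 0 by move/eqP: kq0; rewrite mulf_eq0 (negPf k0) => /eqP.
  rewrite qw0 !mulr0 add0r => b0'.
  split=> //; first exact: plane_coords_eq0.
  (* N^2 sends [b *: u 2%:R] to [2 b *: v 2%:R], and the contribution of [w] to that coordinate is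
     already zero. *)
  by apply: (pchar3_double_eq0 char3); rewrite -[RHS]b0'; ring.
- by rewrite dimV dimC dimvf.
- exact: ca_mul_linearl.
- exact: ca_mul_linearr.
- exact: polar_linearl.
- exact: polar_linearr.
- by move=> x y; case: s_aut => _ sM _; apply: sM.
- exact: polar_aut.
- by move=> a b x y; rewrite mulrDl -scalerAl.
- by move=> a b x y; rewrite mulrDr -scalerAr.
- by move=> w b x y; rewrite scalerDl regular_scaleE scalerA.
- by move=> a b x y; rewrite scalerDr !scalerA mulrC.
- by move=> a b x y; rewrite scalerDr !scalerA mulrC.
- by move=> w b x y; rewrite scalerDl regular_scaleE scalerA.
- by move=> w b x y; rewrite !formE pl ql regular_scaleE; ring.
- by move=> w b x y; rewrite !formE pl ql regular_scaleE; ring.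
- by move=> a b x y; rewrite !regular_scaleE; ring.
- by move=> a b x y; rewrite !regular_scaleE; ring.
- by move=> w b x y; rewrite !formE pl ql regular_scaleE; ring.
- by move=> w b x y; rewrite !formE pl ql regular_scaleE; ring.
- by move=> a b; rewrite !f0E (cvecM cb); congr cvec; ring.
- move=> a w; rewrite f0E !Nf1 (cvecM cb) (scalar_funZ pl) (scalar_funZ ql).
  by congr cvec; ring.
- move=> w a; rewrite f0E !Nf1 (cvecM cb) (scalar_funZ pl) (scalar_funZ ql).
  by congr cvec; ring.
- move=> w w'; rewrite f0E !Nf1 !f1E !(cvecM cb) !cvecB formE.
  (* The two sides differ by a combination of [u 0] and [u 1]. N produces these from the coordinates
     along [v 1] and [v 0], and the entry [t * E] along [e2] cancels the resulting [v 2%:R] term. *)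
  pose E := 2%:R * t * k ^+ 2 * (q w * q w').
  exists (cv 0 (t * E) 0 0 0 (- t * k * (q w * p w' + p w * q w')) E 0).
  by rewrite nilgen_cvec_B12; congr cvec; rewrite /E; ring.
- by move=> a b; rewrite !f0E (cvec_polar cb); ring.
- by move=> a w; rewrite f0E Nf1 (cvec_polar cb); ring.
- by move=> w a; rewrite f0E Nf1 (cvec_polar cb); ring.
- move=> w w'; rewrite !Nf1 !f1E !(cvec_polar cb) formE; apply/subr0_eq.
  (* The difference of the two polar values is -2 times the form on V. *)
  transitivity (3%:R * (k * (p w * q w' - q w * p w'))); first by ring.
  by rewrite (pcharf0 char3) mul0r.
Qed.
End CaseB12.

Section CaseB42.
Hypotheses (su0 : s (u 0) = u 0) (su1 : s (u 1) = u 1).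
Hypothesis su2 : s (u 2%:R) = cv 0 0 0 1 1 0 0 0.

Lemma nilgen_cvec_B42 x y a b c d e f :
  N (cv x y a b c d e f) = cv 0 0 0 c 0 0 0 (- e).
Proof.
rewrite nilgenE /= (cvec_aut cb) // su0 su1 su2.
rewrite (cvec_u0 e1 e2 u v) (cvec_u1 e1 e2 u v) !(cvecM cb).
apply: scalar_ext => phi phiD phiN phiZ.
rewrite !phiD !phiN !phiZ !(cvec_scalar phiD phiZ).
ring.
Qed.

(* The blocks of size 2 are generated by [u 2%:R] and [v 1].  The fixed vectors
   [e1, e2, u 0, v 0] span a matrix algebra, and [g0] identifies [f] with the
   right multiplication by [g0 f] on the odd part. *)
Let g0 (f : 'End(V)) : C := cv (q (f b1)) (p (f b0)) (- (k * q (f b0))) 0 0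
  (k^-1 * p (f b1)) 0 0.
Let f0 : 'Hom('End(V), C) := linfun g0.
Let f1 : 'Hom(V, C) := linfun (fun w => cv 0 0 0 0 (p w) 0 (- (k * q w)) 0).
Let f2 : 'Hom('rV[F]_0, C) := 0.

Let f0E f : f0 f = g0 f.
Proof.
have [_ [pl ql] _ _ _] := pqP.
apply: linfunE => b f' f''; rewrite /g0 cvecZ cvecD; congr cvec;
  by rewrite ?add_lfunE ?scale_lfunE ?pl ?ql; ring.
Qed.

Let f1E w : f1 w = cv 0 0 0 0 (p w) 0 (- (k * q w)) 0.
Proof.
have [_ [pl ql] _ _ _] := pqP.
by apply: linfunE => b x y; rewrite cvecZ cvecD pl ql; congr cvec; ring.
Qed.

Let Nf1 w : N (f1 w) = cv 0 0 0 (p w) 0 0 0 (k * q w).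
Proof. by rewrite f1E nilgen_cvec_B42; congr cvec; ring. Qed.

Lemma semisimplification_B42 : ca_semisimplification char3 s3 (B42 form).
Proof.
have [k0 [pl ql] [wE [p0 q0 p1 q1]] formE trdetE] := pqP.
have c3 : 3%:R = 0 :> F := pcharf0 char3.
have pZ := scalar_funZ pl; have qZ := scalar_funZ ql.
have pD := scalar_funD pl; have qD := scalar_funD ql.
have pE (f : 'End(V)) w : p (f w) = p w * p (f b0) + q w * p (f b1).
  by rewrite {1}(wE w) lfunD !lfunZ pD !pZ.
have qE (f : 'End(V)) w : q (f w) = p w * q (f b0) + q w * q (f b1).
  by rewrite {1}(wE w) lfunD !lfunZ qD !qZ.
have barE f w : lfun_bar f w = (p (f b0) + q (f b1)) *: w - f w.
  by rewrite /lfun_bar add_lfunE opp_lfunE scale_lfunE id_lfunE (trdetE f).1.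
have rkE x y w : (linfun (fun z => form z x *: y) : 'End(V)) w = form w x *: y.
  by rewrite linfunE // => a z t; rewrite linearPl scalerDl scalerA.
have polE f g : polar (@lfun_det F V) f g = p (f b0) * q (g b1) + p (g b0) * q (f b1)
    - q (f b0) * p (g b1) - q (g b0) * p (f b1).
  rewrite /polar (trdetE _).2 (trdetE f).2 (trdetE g).2 !add_lfunE !pD !qD; ring.
have pN x : p (- x) = - p x by rewrite -scaleN1r pZ mulN1r.
have qN x : q (- x) = - q x by rewrite -scaleN1r qZ mulN1r.
apply: (@is_semisimplification_of_decomposition _ char3 (Rep s3)
  'End(V) V 'rV[F]_0 f0 f1 f2).
- by move=> f; rewrite f0E nilgen_cvec_B42 -[RHS](cvec0 e1 e2 u v); congr cvec; ring.
- by move=> w; rewrite Nf1 nilgen_cvec_B42 -[RHS](cvec0 e1 e2 u v); congr cvec; ring.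
- move=> f w b; rewrite f0E Nf1 zero_lfunE !lfun0E addr0 cvecD => /(cvec_eq0 cb).
  rewrite !(addr0, add0r); case=> -[qf1 pf0 kqf0 pw0] [_ kpf1 _ kqw0].
  have qf0 : q (f b0) = 0.
    by move/eqP: kqf0; rewrite oppr_eq0 mulf_eq0 (negPf k0) => /eqP.
  have pf1 : p (f b1) = 0.
    by move/eqP: kpf1; rewrite mulf_eq0 invr_eq0 (negPf k0) => /eqP.
  have qw0 : q w = 0 by move/eqP: kqw0; rewrite mulf_eq0 (negPf k0) => /eqP.
  split; last by apply/rowP => -[].
    apply/lfunP => y; rewrite zero_lfunE; apply: plane_coords_eq0.
      by rewrite pE pf0 pf1 !mulr0 addr0.
    by rewrite qE qf0 qf1 !mulr0 addr0.
  exact: plane_coords_eq0.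
- rewrite dimC !dimvf; change (dim V * dim V + 2 * dim V + 3 * 0 = 8)%N.
  by rewrite -dimvf dimV.
- exact: ca_mul_linearl.
- exact: ca_mul_linearr.
- exact: polar_linearl.
- exact: polar_linearr.
- by move=> x y; case: s_aut => _ sM _; apply: sM.
- exact: polar_aut.
- by move=> f a g h; rewrite comp_lfunDl comp_lfunZl.
- by move=> f a g h; rewrite comp_lfunDr comp_lfunZr.
- move=> w a f g; rewrite !barE !add_lfunE !scale_lfunE !pD !qD !pZ !qZ.
  by apply: scalar_ext => phi phiD phiN phiZ; rewrite !(phiD, phiN, phiZ); ring.
- by move=> f a x y; rewrite linearP.
- by move=> f a x y; rewrite linearP.
- by move=> w a f g; rewrite add_lfunE scale_lfunE.
- move=> y a x x'; apply/lfunP => w.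
  by rewrite add_lfunE scale_lfunE !rkE linearPr scalerDl scalerA.
- move=> x a y y'; apply/lfunP => w.
  by rewrite add_lfunE scale_lfunE !rkE scalerDr !scalerA mulrC.
- by move=> g a f f'; rewrite !polE !add_lfunE !scale_lfunE !pD !qD !pZ !qZ
    regular_scaleE; ring.
- by move=> g a f f'; rewrite !polE !add_lfunE !scale_lfunE !pD !qD !pZ !qZ
    regular_scaleE; ring.
- by move=> w b x y; rewrite !formE pl ql regular_scaleE; ring.
- by move=> w b x y; rewrite !formE pl ql regular_scaleE; ring.
- move=> f g; rewrite !f0E /g0 (cvecM cb) !comp_lfunE !(pE f (g _)) !(qE f (g _)).
  by congr cvec; field.
- move=> f w; rewrite f0E !Nf1 barE /g0 (cvecM cb).
  rewrite !pD !qD !pZ !qZ pN qN (pE f w) (qE f w).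
  by congr cvec; field.
- move=> w f; rewrite f0E !Nf1 /g0 (cvecM cb) (pE f w) (qE f w).
  by congr cvec; field.
(* The odd-odd product holds exactly: every coordinate of the difference is zero or a multiple of
   3. *)
- move=> w w'; exists 0; rewrite f0E /g0 !rkE !formE !pZ !qZ p0 q0 p1 q1.
  rewrite !Nf1 !f1E !(cvecM cb) !cvecB lfun0E -[RHS](cvec0 e1 e2 u v).
  congr cvec; rewrite ?subrr //.
  + by transitivity (3%:R * - (k * (p w * q w'))); [ring | rewrite c3 mul0r].
  + by transitivity (3%:R * (k * (q w * p w'))); [ring | rewrite c3 mul0r].
  + by transitivity (3%:R * - (k ^+ 2 * (q w * q w'))); [ring | rewrite c3 mul0r].
  + ring.
  + ring.
  + by transitivity (3%:R * - (p w * p w')); [field | rewrite c3 mul0r].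
  + ring.
  + ring.
- by move=> f g; rewrite !f0E /g0 (cvec_polar cb) polE; field.
- by move=> f w; rewrite f0E Nf1 /g0 (cvec_polar cb); ring.
- by move=> w f; rewrite f0E Nf1 /g0 (cvec_polar cb); ring.
- move=> w w'; rewrite !Nf1 !f1E !(cvec_polar cb) formE; apply/subr0_eq.
  transitivity (3%:R * (k * (p w * q w' - q w * p w'))); first by ring.
  by rewrite c3 mul0r.
Qed.
End CaseB42.
End SplitCayley.

Lemma ord0_row_eq0 (F : fieldType) (x : 'rV[F]_0) : x = 0.
Proof. by apply/rowP => -[]. Qed.

(** * The case of a fixed quadratic étale subalgebra *)

Section QuadraticSubalgebra.
Variables (F : fieldType) (C : composition_algebra F).
Hypothesis char3 : 3%N \in [pchar F].
Variables (s : 'End(C)) (s_aut : is_automorphism s).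
Hypothesis s3 : (s \o s \o s)%VF = \1%VF.
Variables (e1 e2 : C) (u v : 'I_3 -> C).
Hypothesis cb : canonical_basis e1 e2 u v.
Hypothesis dimC : \dim {:C} = 8%N.
Local Notation cv := (cvec e1 e2 u v).
Local Notation N := (nilgen (Rep s3)).
Local Notation M := (ca_mul C).
Local Notation pol := (polar (@ca_norm F C)).
Local Notation one := (e1 + e2).

Let oneE : one = cv 1 1 0 0 0 0 0 0.
Proof.
rewrite [LHS](congr2 +%R (cvec_e1 e1 e2 u v) (cvec_e2 e1 e2 u v)) cvecD.
by rewrite !(addr0, add0r).
Qed.

Lemma ca_sqr z : M z z = pol z one *: z - ca_norm z *: one.
Proof.
have [x [y [a [b [c [d [e [f ->]]]]]]]] := cvec_surj cb z.
(* Since 2 is invertible, the norm is recovered from its polar form. *)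
have -> : ca_norm (cv x y a b c d e f) = x * y + (a * d + b * e + c * f).
  apply/subr0_eq/(pchar3_double_eq0 char3); rewrite mulrBr -polarxx (cvec_polar cb); ring.
rewrite oneE (cvec_polar cb) (cvecM cb) !cvecZ cvecB; congr cvec; ring.
Qed.

Lemma ca_altl z w : M z (M z w) = M (M z z) w.
Proof.
have [x [y [a [b [c [d [e [f ->]]]]]]]] := cvec_surj cb z.
have [x' [y' [a' [b' [c' [d' [e' [f' ->]]]]]]]] := cvec_surj cb w.
rewrite !(cvecM cb); congr cvec; ring.
Qed.

(** The adjoint of left multiplication by [z] is left multiplication by its conjugate, so it is skew
    when [z] has trace 0. *)
Lemma polar_mull z w w' : pol (M z w) w' = pol z one * pol w w' - pol w (M z w').
Proof.
have [x [y [a [b [c [d [e [f ->]]]]]]]] := cvec_surj cb z.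
have [x' [y' [a' [b' [c' [d' [e' [f' ->]]]]]]]] := cvec_surj cb w.
have [x1 [y1 [a1 [b1 [c1 [d1 [e0 [f1 ->]]]]]]]] := cvec_surj cb w'.
rewrite oneE !(cvecM cb) !(cvec_polar cb); ring.
Qed.

Lemma polar_one_one : pol one one = 2%:R.
Proof.
rewrite {1 2}(congr2 +%R (cvec_e1 e1 e2 u v) (cvec_e2 e1 e2 u v)) cvecD.
by rewrite (cvec_polar cb); ring.
Qed.

Lemma one_neq0 : one != 0.
Proof.
apply/eqP => one0; have := polar_one_one; rewrite one0 polar0r => two0.
have /eqP := @pchar3_double_eq0 _ 1 char3 (etrans (mulr1 _) (esym two0)).
by rewrite oner_eq0.
Qed.

Variable K : {vspace C}.
Hypothesis Kq : quadratic_etale_subalgebra K.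
Hypothesis Ks : forall x, x \in K -> s x = x.

Lemma quadratic_subalgebra_one : one \in K.
Proof.
case: Kq => _ [e [eu eK _ _]]; suff <- : e = one by [].
by have [<- _] := cb_unity cb e; have [_ ->] := eu one.
Qed.

(** A vector of [K] outside the line of the unity is shifted to trace 0; its square is then a
    scalar, nonzero because an étale algebra has no nilpotents. *)
Lemma quadratic_subalgebra_gen : exists (i : C) (c : F),
  [/\ c != 0, i \in K, M i i = c *: one, pol i one = 0 &
      forall x, x \in K -> exists a b, x = a *: one + b *: i].
Proof.
have oneK := quadratic_subalgebra_one.
case: Kq => dimK [e [_ _ closed et]].
have [k kK k1] : exists2 k, k \in K & k \notin <[one]>%VS.
  apply/subvPn; apply: contraTN isT => /dimvS.
  by rewrite dimK dim_vline one_neq0.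
(* The unity has trace 2, so the trace of [i] is three times that of [k]. *)
pose i := k + pol k one *: one.
have iK : i \in K by rewrite memvD // memvZ.
have i1 : i \notin <[one]>%VS.
  apply: contra k1 => i1; have -> : k = i - pol k one *: one by rewrite addrK.
  by rewrite memvB // memvZ // memv_line.
have ti : pol i one = 0.
  rewrite polarDl polarZl polar_one_one.
  transitivity (3%:R * pol k one); first by ring.
  by rewrite (pcharf0 char3) mul0r.
have ii : M i i = - ca_norm i *: one.
  by rewrite ca_sqr ti scale0r add0r scaleNr.
exists i, (- ca_norm i); split=> //.
- apply: contra i1 => /eqP c0; rewrite c0 scale0r in ii.
  case: et => n [L [p [_ pM _ puniq]]].
  pose x := vsproj K i; have xi : vsval x = i by rewrite vsprojK.
  have xx : sub_mul x x = 0 by rewrite /sub_mul xi ii linear0.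
  have px j : p j x = 0.
    have := pM j x x; rewrite xx lfun0E => /esym/eqP.
    by rewrite mulf_eq0 => /orP[] /eqP.
  have [y [_ yu]] := puniq (fun j => 0).
  have x0 : x = 0 by rewrite -(yu x px) -(yu 0) // => j; rewrite lfun0E.
  by rewrite -xi x0 linear0 mem0v.
- have Ksum : (<[one]> + <[i]>)%VS = K.
    apply/eqP; rewrite eqEdim subv_add -!memvE oneK iK dimK.
    rewrite ltnNge; apply: contra i1 => d1.
    have /eqP -> : (<[one]> == <[one]> + <[i]>)%VS.
      by rewrite eqEdim addvSl dim_vline one_neq0.
    by rewrite memvE addvSr.
  move=> x; rewrite -Ksum => /memv_addP[_ /vlineP[a ->] [_ /vlineP[b ->] ->]].
  by exists a, b.
Qed.

Lemma polar_nilgen_fixed x y : s x = x -> pol (N y) x = 0.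
Proof.
move=> sx; rewrite nilgenE /= -scaleN1r polarDl polarZl -{1}sx polar_aut //.
by rewrite mulN1r subrr.
Qed.

(** The adjoint of [s] is its inverse, and (s^-1 - 1)^2 = s^-2 (s - 1)^2 = s N^2. *)
Lemma polar_nilgen2 x y : pol (N (N x)) y = pol x (s (N (N y))).
Proof.
have s3E z : s (s (s z)) = z.
  by rewrite -[RHS](id_lfunE z) -s3 !comp_lfunE.
have polN z z' : pol z (- z') = - pol z z' by rewrite -scaleN1r polarZr mulN1r.
have polN' z z' : pol (- z) z' = - pol z z' by rewrite -scaleN1r polarZl mulN1r.
have ad z z' : pol (s z) z' = pol z (s (s z')).
  by rewrite -{1}(s3E z') polar_aut.
rewrite !nilgenE /= !lfunB !polarDl !polarDr !polN !polN' !polarDl !polarDr !polN !polN'.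
by rewrite !ad !s3E; ring.
Qed.

Hypothesis N2 : ((s - \1) \o (s - \1))%VF != 0.

Lemma nilgen2_independent i c : c != 0 -> i \in K -> M i i = c *: one ->
    pol i one = 0 ->
  exists w1 w2, forall a b, a *: N (N w1) + b *: N (N w2) = 0 -> a = 0 /\ b = 0.
Proof.
move=> c0 iK ii ti.
have ialt x : M i (M i x) = c *: x.
  by rewrite ca_altl ii ca_mulZl (cb_unity cb x).1.
have Ni x : N (M i x) = M i (N x).
  case: (s_aut) => _ sM _.
  by rewrite !nilgenE /= sM (Ks iK) -[in RHS]scaleN1r ca_mulDr ca_mulZr scaleN1r.
have /lfunPn[w] := N2; rewrite comp_lfunE zero_lfunE => Nw.
have {Nw} z0 : N (N w) != 0 by exact: Nw.
set z := N (N w) in z0.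
(* If [z] is no eigenvector of [i], then [z] and [M i z] are independent and both lie in the image
   of N^2, since [i] is fixed and multiplication by it commutes with N. *)
have [/vlineP[al iz]|iz] := boolP (M i z \in <[z]>%VS); last first.
  exists w, (M i w) => a b; rewrite !Ni -/z => ab.
  have b0 : b = 0.
    apply/eqP; apply: contraNT iz => b0; apply/vlineP; exists (- (b^-1 * a)).
    rewrite scaleNr -scalerA; apply/eqP; rewrite -addr_eq0; apply/eqP.
    by rewrite addrC -[M i z]scale1r -(mulVf b0) -scalerA -scalerDr ab scaler0.
  split=> //; move/eqP: ab; rewrite b0 scale0r addr0 scaler_eq0 (negPf z0) orbF.
  by move/eqP.
have al2 : al * al = c.
  have := ialt z; rewrite iz ca_mulZr iz scalerA => /eqP.
  by rewrite -subr_eq0 -scalerBl scaler_eq0 (negPf z0) orbF subr_eq0 => /eqP.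
have al0 : al != 0 by apply: contraNneq c0 => e; rewrite -al2 e mul0r.
have [y zy] : exists y, pol z y != 0.
  have [/existsP[j zj]|/existsPn zb] :=
    boolP [exists j : 'I_(\dim {:C}), pol z (vbasis {:C})`_j != 0].
    by exists (vbasis {:C})`_j.
  case/eqP: z0; apply: ca_polar_nondeg => y; rewrite (coord_vbasis (memvf y)).
  rewrite (big_morph (pol z) (polarDr z) (polar0r z)) big1 // => j _.
  by rewrite polarZr (eqP (negbNE (zb j))) mulr0.
(* Up to a factor 2, the projection of [y] to the eigenspace of [i] for [- al]. Its pairing with [z]
   is twice that of [y], hence nonzero, and moving N^2 across the form shows that N^2 does not kill
   it. *)
pose y' := y - al^-1 *: M i y.
have iy' : M i y' = - al *: y'.
  rewrite /y' -scaleN1r ca_mulDr !ca_mulZr ialt -al2 scalerDr !scalerA addrC.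
  by congr (_ *: _ + _); [|rewrite -[LHS]scale1r; congr (_ *: _)]; field.
have ziy : pol z (M i y) = - (al * pol z y).
  by rewrite -polarZl -iz polar_mull ti mul0r sub0r opprK.
have zy' : pol z y' != 0.
  rewrite /y' -scaleN1r polarDr !polarZr ziy.
  have -> : pol z y + -1 * (al^-1 * - (al * pol z y)) = 2%:R * pol z y by field.
  by apply: contra zy => /eqP/(pchar3_double_eq0 char3)/eqP.
have Ny' : N (N y') != 0.
  apply: contraNneq zy' => Ny; rewrite /z polar_nilgen2 Ny lfun0E polar0r //.
exists w, y' => a b ab.
have iN : M i (N (N y')) = - al *: N (N y') by rewrite -!Ni iy' !lfunZ.
(* Multiplying the relation by [i] separates the eigenvalues [al] and [- al], which differ because 2
   is invertible. *)
have ab' : a *: (al *: z) + b *: (- al *: N (N y')) = 0.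
  by rewrite -iz -iN -!ca_mulZr -ca_mulDr ab; exact: linear0r.
have a0 : a = 0.
  have e : al *: (a *: z + b *: N (N y')) + (a *: (al *: z) + b *: (- al *: N (N y')))
      = (2%:R * (al * a)) *: z.
    by apply: scalar_ext => phi phiD phiN phiZ; rewrite !(phiD, phiZ); ring.
  move/eqP: e; rewrite ab ab' scaler0 addr0 eq_sym scaler_eq0 (negPf z0) orbF.
  move=> /eqP/(pchar3_double_eq0 char3)/eqP; rewrite mulf_eq0 (negPf al0).
  by move/eqP.
split=> //; move/eqP: ab; rewrite a0 scale0r add0r scaler_eq0 (negPf Ny') orbF.
by move/eqP.
Qed.

Lemma semisimplification_quadratic :
  ca_semisimplification char3 s3 (sub_superalgebra K).
Proof.
have [i [c [c0 iK ii ti Kgen]]] := quadratic_subalgebra_gen.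
have [w1 [w2 indep]] := nilgen2_independent c0 iK ii ti.
have [dimK [_ [_ _ Kmul _]]] := Kq.
pose f0 : 'Hom(subvs_of K, C) := linfun vsval.
pose f2 : 'Hom('rV[F]_2, C) := linfun (fun r : 'rV[F]_2 => r 0 0 *: w1 + r 0 1 *: w2).
have f0E x : f0 x = vsval x by rewrite lfunE.
have f2E r : f2 r = (r : 'rV_2) 0 0 *: w1 + (r : 'rV_2) 0 1 *: w2.
  apply: linfunE => a x y; rewrite !mxE !scalerDl scalerDr !scalerA.
  by rewrite addrACA.
have subE (x : subvs_of K) (y : subvs_of K) : vsval (sub_mul x y) = M (vsval x) (vsval y).
  by rewrite vsprojK // Kmul ?subvsP.
have fixK (x : subvs_of K) : s (vsval x) = vsval x by rewrite Ks ?subvsP.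
have two_inj (a : F) : 2%:R * a = 0 -> a = 0 := @pchar3_double_eq0 F a char3.
apply: (@is_semisimplification_of_decomposition _ char3 (Rep s3) (subvs_of K)
  'rV[F]_0 'rV[F]_2 f0 0 f2).
- by move=> x; rewrite f0E nilgenE /= fixK subrr.
- by move=> y; rewrite zero_lfunE !lfun0E.
- move=> x y r; rewrite zero_lfunE lfun0E addr0 f0E => e.
  have [a [b xE]] := Kgen _ (subvsP x).
  (* Vectors in the image of N are orthogonal to fixed vectors, so the relation makes [x] orthogonal
     to [K]. The form is nondegenerate on [K], with values 2 and -2c on the orthogonal basis [one],
     [i]; hence [x] vanishes. *)
  have xperp y' : y' \in K -> pol (vsval x) y' = 0.
    move=> /Ks y'K; have := congr1 (pol^~ y') e.
    by rewrite /= polarDl polar_nilgen_fixed // addr0 [pol 0 y']polarC polar0r.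
  have := xperp _ iK; have := xperp _ quadratic_subalgebra_one.
  have ii0 : pol i i = - (2%:R * c).
    have := polar_mull i one i; rewrite ti mul0r sub0r.
    rewrite (cb_unity cb i).2 ii polarZr polar_one_one => ->.
    by rewrite mulrC.
  rewrite xE !polarDl !polarZl ti (polarC one i) ti polar_one_one ii0 !mulr0.
  rewrite addr0 add0r mulrC => /two_inj a0.
  rewrite mulrN mulrCA => /eqP; rewrite oppr_eq0 => /eqP/two_inj/eqP.
  rewrite mulf_eq0 (negPf c0) orbF => /eqP b0.
  have x0 : vsval x = 0 by rewrite xE a0 b0 !scale0r addr0.
  split; [exact/val_inj | exact: ord0_row_eq0 |].
  move: e; rewrite x0 add0r f2E !lfunD !lfunZ => /indep[r0 r1].
  apply/rowP => j; rewrite mxE; case: (I2P j) => ->; first exact: r0.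
  exact: r1.
- rewrite dimC !dimvf; change (dim (subvs_of K) + 2 * 0 + 3 * 2 = 8)%N.
  by rewrite -dimvf; rewrite (_ : \dim {:subvs_of K} = 2%N) // dimvf -dimK.
- exact: ca_mul_linearl.
- exact: ca_mul_linearr.
- exact: polar_linearl.
- exact: polar_linearr.
- by move=> x y; case: s_aut => _ sM _; apply: sM.
- exact: polar_aut.
- move=> y a x x'; apply: subvs_inj.
  by rewrite subE linearP /= !subE ca_mulDl ca_mulZl.
- move=> x a y y'; apply: subvs_inj.
  rewrite subE [vsval (a *: y + y')]linearP [RHS]linearP /= !subE.
  by rewrite ca_mulDr ca_mulZr.
- by move=> y a x x'; rewrite scaler0 addr0.
- by move=> y a x x'; rewrite scaler0 addr0.
- by move=> y a x x'; rewrite scaler0 addr0.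
- by move=> y a x x'; rewrite scaler0 addr0.
- by move=> y a x x'; rewrite scaler0 addr0.
- by move=> y a x x'; rewrite scaler0 addr0.
- by move=> y a x x'; rewrite linearP polarDl polarZl.
- by move=> x a y y'; rewrite linearP polarDr polarZr.
- by move=> y a x x'; rewrite scaler0 addr0.
- by move=> y a x x'; rewrite scaler0 addr0.
- by move=> x y; rewrite !f0E subE.
- by move=> x y; rewrite !zero_lfunE !lfun0E; apply/esym/linear0r.
- by move=> x y; rewrite !zero_lfunE !lfun0E; apply/esym/linear0l.
- move=> x y; exists 0; rewrite !zero_lfunE !lfun0E.
  by rewrite linear0l subrr subr0.
- by move=> x y; rewrite !f0E.
- by move=> x y; rewrite !zero_lfunE !lfun0E polar0r.
- by move=> x y; rewrite !zero_lfunE !lfun0E polarC polar0r.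
- by move=> x y; rewrite !zero_lfunE !lfun0E polar0r subrr.
Qed.

End QuadraticSubalgebra.

(** * The four cases assembled *)

Theorem mainTheorem1 (F : fieldType) (char3 : 3%N \in [pchar F])
    (V : vectType F) (form : {biscalar V})
    (dimV : \dim {:V} = 2%N)
    (form_alt : forall w : V, form w w = 0)
    (form_neq0 : exists w1 w2 : V, form w1 w2 != 0)
    (C : composition_algebra F) (splitC : is_split_cayley C)
    (s : 'End(C)) (s_aut : is_automorphism s)
    (s3 : (s \o s \o s)%VF = \1%VF) (s_neq1 : s != \1%VF) :
  [/\ (exists (e1 e2 : C) (u v : 'I_3 -> C),
         [/\ canonical_basis e1 e2 u v, s (u 0) = u 0, s (u 1) = u 1
           & s (u 2%:R) = u 2%:R + u 1]) ->
      ca_semisimplification_iso char3 s3 (B42 form),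
      forall K : {vspace C},
        ((s - \1) \o (s - \1))%VF != 0 ->
        quadratic_etale_subalgebra K ->
        (forall x, x \in K -> s x = x) ->
      ca_semisimplification_iso char3 s3 (sub_superalgebra K),
      (exists (e1 e2 : C) (u v : 'I_3 -> C),
         [/\ canonical_basis e1 e2 u v, s (u 0) = u 0, s (u 1) = u 1
           & s (u 2%:R) = u 2%:R + v 2%:R - (e1 - e2)]) ->
      ca_semisimplification_iso char3 s3 (B12 form)
    & (exists (e1 e2 : C) (u v : 'I_3 -> C),
         [/\ canonical_basis e1 e2 u v, s (u 0) = u 0, s (u 1) = u 1
           & s (u 2%:R) = u 2%:R + u 1 + v 2%:R - (e1 - e2)]) ->
      ca_semisimplification_iso char3 s3 (B12 form)].
Proof.
have [[_ dimC] [e1' [e2' [u' [v' cb']]]]] := splitC.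
have [b0 [b1 [p [q [k pqP]]]]] := plane_coords_exist dimV form_alt form_neq0.
(* Parts (3) and (4) differ only in the coefficient [t] of [u 1], which is 0 or 1. *)
have case34 (t : F) (e1 e2 : C) (u v : 'I_3 -> C) :
    canonical_basis e1 e2 u v -> s (u 0) = u 0 -> s (u 1) = u 1 ->
    s (u 2%:R) = u 2%:R + t *: u 1 + v 2%:R - (e1 - e2) ->
    ca_semisimplification_iso char3 s3 (B12 form).
  move=> cb su0 su1 su2; apply: ca_semisimplification_isoP => //.
  have su2' : s (u 2%:R) = cvec e1 e2 u v (-1) 1 0 t 1 0 0 1.
    rewrite su2; apply: scalar_ext => phi phiD phiN phiZ.
    by rewrite (cvec_scalar phiD phiZ) !(phiD, phiN, phiZ); ring.
  exact (semisimplification_B12 char3 s_aut s3 cb dimC dimV pqP su0 su1 su2').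
split.
- move=> [e1 [e2 [u [v [cb su0 su1 su2]]]]].
  apply: ca_semisimplification_isoP => //.
  have su2' : s (u 2%:R) = cvec e1 e2 u v 0 0 0 1 1 0 0 0.
    rewrite su2; apply: scalar_ext => phi phiD phiN phiZ.
    by rewrite (cvec_scalar phiD phiZ) !(phiD, phiN, phiZ); ring.
  exact (semisimplification_B42 char3 s_aut s3 cb dimC dimV pqP su0 su1 su2').
- move=> K N2 Kq Ks; apply: ca_semisimplification_isoP => //.
  (* Here the canonical basis comes from splitness and need not be adapted to [s]; it serves only to
     compute in the algebra. *)
  exact: (semisimplification_quadratic char3 s_aut s3 cb').
- move=> [e1 [e2 [u [v [cb su0 su1 su2]]]]]; apply: (case34 0) cb su0 su1 _.
  by rewrite su2 scale0r addr0.
- move=> [e1 [e2 [u [v [cb su0 su1 su2]]]]]; apply: (case34 1) cb su0 su1 _.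
  by rewrite su2 scale1r.
Qed.
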